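(* For each $\iota>0$, there is $D_0$ such that if $D\ge D_0$ and $\mathcal{H}$ is a $3$-uniform $2$-simple hypergraph with maximum degree at most $D$, then $$\chi'(\mathcal{H}) \le \left(1-\frac{2}{9}+\frac{2}{3^5}+\iota\right)3D.$$ In particular, for all sufficiently large $D$, every $3$-uniform $2$-simple hypergraph with maximum degree at most $D$ has chromatic index at most $2.3581\,D$.
   Context: A hypergraph $\mathcal{H}$ consists of a vertex set $V(\mathcal{H})$ and a multiset $E(\mathcal{H})$ of edges, each a subset of $V(\mathcal{H})$ (repeated edges are allowed a priori and copies count as distinct edges). It is $k$-uniform if every edge has size $k$, and $t$-simple if every two distinct edges intersect in at most $t$ vertices. The degree of a vertex is the number of edges (with multiplicity) containing it. The chromatic index $\chi'(\mathcal{H})$ is the smallest number of colors needed to color the edges of $\mathcal{H}$ so that any two distinct intersecting edges receive distinct colors. *)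

(* Defs.v *)
From mathcomp Require Import all_boot all_order all_algebra.
From mathcomp Require Import reals.

Set Implicit Arguments.
Unset Strict Implicit.
Unset Printing Implicit Defensive.

(* The multiset of edges is a finite type of edge labels together with the
   vertex set of each label: parallel edges are distinct labels with equal
   vertex sets. *)
Record hypergraph := Hypergraph {
  vertex : finType;
  edge : finType;
  vset : edge -> {set vertex} }.

Definition uniform (k : nat) (H : hypergraph) : Prop :=
  forall e : edge H, #|vset e| = k.

Definition simple (t : nat) (H : hypergraph) : Prop :=
  forall e f : edge H, e != f -> #|vset e :&: vset f| <= t.

Definition degree (H : hypergraph) (v : vertex H) : nat :=
  #|[set e : edge H | v \in vset e]|.

Definition max_degree (H : hypergraph) : nat := \max_(v : vertex H) degree v.

Definition proper_edge_coloring (H : hypergraph) (C : finType)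
    (c : {ffun edge H -> C}) : bool :=
  [forall e : edge H, forall f : edge H,
     (e != f) && (vset e :&: vset f != set0) ==> (c e != c f)].

Definition edge_colorable (H : hypergraph) (n : nat) : bool :=
  [exists c : {ffun edge H -> 'I_n}, proper_edge_coloring c].

Lemma edge_colorable_card (H : hypergraph) : edge_colorable H #|edge H|.
Proof.
apply/existsP; exists [ffun e => enum_rank e].
apply/forallP => e; apply/forallP => f; apply/implyP => /andP[ef _].
by rewrite !ffunE (inj_eq enum_rank_inj).
Qed.

Lemma edge_colorable_exists (H : hypergraph) : exists n, edge_colorable H n.
Proof. by exists #|edge H|; exact: edge_colorable_card. Qed.

Definition chromatic_index (H : hypergraph) : nat :=
  ex_minn (edge_colorable_exists H).

(* Main.v *)
(* Colours are used up in batches.  With n = 3D, an edge wins a lottery round if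
   it precedes all its neighbours in a uniformly random order padded so that
   every edge wins with probability exactly 1/n; the winners form a matching.
   Around an edge e = abc, inclusion-exclusion bounds the probability that no
   neighbour of e wins from below by 1 - 1 + (pairs) / n^2 - (triples) / n^3,
   counting non-incident pairs and triples of neighbours taken at different
   vertices of e: overlapping neighbourhoods make such pairs win together more
   often, which outweighs the effect on triples.  Two neighbours of e are
   incident essentially only through the boundedly many vertices x of large
   degree towards e.  As the edges are distinct, almost every neighbour of e has
   at most one such x, so the degree bound D at x leaves at least 2 D^2 good
   pairs, and the worst case is l = 2/9 - 2/3^5.

   Running independent rounds one after the other, keeping a winner only when
   none of its neighbours has won before, yields a random matching that contains
   each edge with probability about (1 + l + l^2 + ...) / n = 1 / (3 (1 - l) D).
   A batch of eps D independent such matchings lowers, by a Chernoff bound at each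
   vertex and the local lemma, all degrees by about eps D / (3 (1 - l)) at once;
   iterate until the degree is bounded. *)
Require Import Defs.
From mathcomp Require Import all_boot all_order all_algebra.
From mathcomp Require Import reals.
From mathcomp Require Import all_fingroup sequences exp zify ring lra.

Set Implicit Arguments.
Unset Strict Implicit.
Unset Printing Implicit Defensive.
Import Order.TTheory GRing.Theory Num.Theory.

(** * The local lemma and resampling *)

Section LocalLemma.
Variables (Omega I : finType) (A : I -> {set Omega}).

Definition avoid (S : {set I}) : {set Omega} := \bigcap_(j in S) ~: A j.

Lemma avoidP (S : {set I}) w : reflect (forall j, j \in S -> w \notin A j) (w \in avoid S).
Proof.
apply: (iffP bigcapP) => H j jS; move: (H j jS); by rewrite inE.
Qed.

Lemma avoidS (S S' : {set I}) : S \subset S' -> avoid S' \subset avoid S.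
Proof.
move=> /subsetP sS; apply/subsetP => w /avoidP H; apply/avoidP => j /sS; exact: H.
Qed.

Lemma card_avoidU (S : {set I}) i : #|avoid (i |: S)| = #|avoid S| - #|A i :&: avoid S|.
Proof.
rewrite -[in RHS](cardsID (A i) (avoid S)) setIC addKn; apply: eq_card => w.
rewrite !inE; apply/avoidP/andP => [H|[iA /avoidP H] j].
  split; first by apply: H; rewrite setU11.
  by apply/avoidP => j jS; apply: H; rewrite setU1r.
by case/setU1P => [->|/H].
Qed.

Lemma lovasz_local (nb : I -> {set I}) (d : nat) :
    0 < d -> 0 < #|Omega| -> (forall i, #|nb i| <= d) ->
    (forall i (S : {set I}), [disjoint S & nb i] -> i \notin S ->
       #|A i :&: avoid S| * #|Omega| = #|A i| * #|avoid S|) ->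
    (forall i, 4 * d * #|A i| <= #|Omega|) ->
  exists w, forall i, w \notin A i.
Proof.
move=> d0 O0 nbd ind small.
have key m : forall (S : {set I}), #|S| <= m ->
    0 < #|avoid S| /\ forall i, i \notin S -> 2 * d * #|A i :&: avoid S| <= #|avoid S|.
  elim: m => [|m IH] S Sm.
    have -> : S = set0 by apply/eqP; rewrite -cards_eq0 -leqn0.
    have -> : avoid set0 = setT by rewrite /avoid big_set0.
    rewrite cardsT; split=> // i _; rewrite setIT.
    by apply: leq_trans (small i); rewrite -!mulnA leq_mul2r orbT.
  have pos : 0 < #|avoid S|.
    case: (set_0Vmem S) => [->|[i iS]].
      by rewrite /avoid big_set0 cardsT.
    have Sm' : #|S :\ i| <= m by rewrite -ltnS (leq_trans _ Sm) // [X in _ < X](cardsD1 i S) iS.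
    have [p0 /(_ i)] := IH _ Sm'; rewrite setD11 => /(_ isT) h.
    rewrite -(setD1K iS) card_avoidU subn_gt0.
    move: p0 h; set x := #|_|; set y := #|_ :&: _| => p0 h.
    by clear -d0 p0 h; nia.
  split=> // i iS.
  set S1 := S :&: nb i; set S2 := S :\: nb i.
  have dis : [disjoint S2 & nb i] by rewrite disjoint_sym disjoints_subset setCD subsetUr.
  have iS2 : i \notin S2 by rewrite inE (negPf iS) andbF.
  have h2 : 4 * d * #|A i :&: avoid S| <= #|avoid S2|.
    apply: (@leq_trans (4 * d * #|A i :&: avoid S2|)).
      by rewrite leq_mul2l subset_leq_card ?orbT // setIS // avoidS // subsetDl.
    rewrite -(leq_pmul2r O0) -mulnA (ind _ _ dis iS2) mulnA mulnC leq_mul2l.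
    by rewrite small orbT.
  have half : #|avoid S2| <= 2 * #|avoid S|.
    have [S12|S12] := eqVneq S1 set0.
      have -> : S2 = S by apply/setDidPl; rewrite -setI_eq0; apply/eqP.
      by rewrite mul2n -addnn leq_addr.
    have S2m : #|S2| <= m.
      rewrite -ltnS (leq_trans _ Sm) // -[#|S|](cardsID (nb i) S) -/S1 -/S2.
      by rewrite -[X in X < _]add0n ltn_add2r card_gt0.
    have [_ H] := IH _ S2m.
    have cov : avoid S2 \subset avoid S :|: \bigcup_(j in S1) (A j :&: avoid S2).
      apply/subsetP => w w2; rewrite inE orbC.
      case: (boolP (w \in \bigcup_(j in S1) _)) => //= wn.
      apply/avoidP => j jS; case: (boolP (j \in nb i)) => jn; last first.
        by move/avoidP: w2; apply; rewrite inE jn.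
      apply: contraNN wn => wj; apply/bigcupP; exists j; rewrite ?inE ?jS ?jn //.
      by rewrite wj.
    have bnd : 2 * d * #|\bigcup_(j in S1) (A j :&: avoid S2)| <= d * #|avoid S2|.
      apply: (@leq_trans (\sum_(j in S1) (2 * d * #|A j :&: avoid S2|))).
        rewrite -big_distrr /= leq_mul2l; apply/orP; right.
        elim/big_rec2: _ => [|j x y _ xy]; first by rewrite cards0.
        by rewrite (leq_trans (leq_card_setU _ _).1) // leq_add2l.
      apply: (@leq_trans (\sum_(j in S1) #|avoid S2|)).
        apply: leq_sum => j; rewrite inE => /andP[_ jn]; apply: H.
        by rewrite inE jn.
      rewrite sum_nat_const leq_mul2r (leq_trans _ (nbd i)) ?orbT //.
      by rewrite subset_leq_card // subsetIr.
    have := leq_trans (subset_leq_card cov) (leq_card_setU _ _).1.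
    move: bnd; set u := #|\bigcup_(_ in _) _|; set x := #|avoid S2| => bnd hx.
    have : 2 * u <= x by rewrite -(leq_pmul2l d0) mulnA [d * 2]mulnC.
    move=> hu; rewrite -(leq_add2r (2 * u)) -mulnDr (leq_trans _ (leq_mul (leqnn 2) hx)) //.
    by rewrite [2 * x]mul2n -addnn leq_add2l.
  rewrite -(leq_pmul2l (isT : 0 < 2)) (leq_trans _ half) //.
  by rewrite mulnA mulnA.
have [w0 _] := key #|I| setT (max_card _).
case/card_gt0P: w0 => w /avoidP H; exists w => i; exact: H.
Qed.

End LocalLemma.

(* [agree B w w'] reads "w and w' coincide as far as the coordinates in B are
   concerned"; a group-like family of bijections of the sample space that
   re-randomises B and leaves everything else alone stands in for a product
   structure. *)
Definition resamplable (E Omega : finType) (agree : {set E} -> Omega -> Omega -> Prop) :=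
  forall B : {set E}, exists (G : finType) (act : G -> Omega -> Omega),
    [/\ 0 < #|G|, (forall g, injective (act g)),
        (forall g (C : {set E}) w, [disjoint B & C] -> agree C (act g w) w) &
        (forall w w', exists2 h : G -> G, bijective h &
           forall g, agree B (act g w) (act (h g) w'))].

Definition determined (E Omega : finType) (agree : {set E} -> Omega -> Omega -> Prop)
    (B : {set E}) (X : {set Omega}) :=
  forall w w', agree B w w' -> (w \in X) = (w' \in X).

Lemma resamplable_indep (E Omega : finType) (agree : {set E} -> Omega -> Omega -> Prop)
    (B C : {set E}) (X Y : {set Omega}) :
    resamplable agree -> [disjoint B & C] ->
    determined agree B X -> determined agree C Y ->
  #|X :&: Y| * #|Omega| = #|X| * #|Y|.
Proof.
move=> /(_ B)[G [act [G0 actI actC actB]]] BC detX detY.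
case: (pickP (@predT Omega)) => [w0 _|no]; last first.
  have -> : X = set0 by apply/setP => w; have := no w.
  by rewrite set0I cards0.
pose c := #|[set g | act g w0 \in X]|.
have cst w : #|[set g | act g w \in X]| = c.
  have [h hb hh] := actB w w0.
  rewrite /c -[RHS](on_card_preimset (f := h)); last by apply: onW_bij.
  by apply: eq_card => g; rewrite !inE (detX _ _ (hh g)).
have main (Z : {set Omega}) : determined agree C Z -> #|X :&: Z| * #|G| = c * #|Z|.
  move=> detZ.
  transitivity (\sum_(g : G) \sum_(w in Z) (act g w \in X)).
    rewrite mulnC -sum_nat_const; apply: eq_bigr => g _.
    have bij : bijective (act g) by apply: injF_bij.
    rewrite -[LHS](on_card_preimset (f := act g)); last by apply: onW_bij.
    rewrite -sum1_card big_mkcond [RHS]big_mkcond /=; apply: eq_bigr => w _.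
    rewrite !inE (detZ _ _ (actC g C w BC)).
    by case: (act g w \in X); case: (w \in Z).
  rewrite exchange_big /= mulnC -sum_nat_const; apply: eq_bigr => w _.
  rewrite -(cst w) -sum1_card [RHS]big_mkcond /=; apply: eq_bigr => g _.
  by rewrite inE; case: (_ \in X).
have h1 := main Y detY.
have h2 : #|X| * #|G| = c * #|Omega|.
  by rewrite -(cardsT Omega) -(main setT) ?setIT // => w w' _; rewrite !inE.
apply/eqP; rewrite -(eqn_pmul2r G0) mulnAC h1.
by rewrite [#|X| * _ * _]mulnAC h2 mulnAC.
Qed.

Lemma resamplable_unit (E : finType) :
  resamplable (fun (_ : {set E}) (_ _ : unit) => True).
Proof.
move=> B; exists unit, (fun _ w => w); split=> //; [by rewrite card_unit | by move=> _ w w' |].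
by move=> w w'; exists (fun g : unit => g) => //; exists (fun g : unit => g).
Qed.

Lemma resamplable_prod (E O1 O2 : finType)
    (agree1 : {set E} -> O1 -> O1 -> Prop) (agree2 : {set E} -> O2 -> O2 -> Prop) :
    resamplable agree1 -> resamplable agree2 ->
  resamplable (fun B (w w' : O1 * O2) => agree1 B w.1 w'.1 /\ agree2 B w.2 w'.2).
Proof.
move=> r1 r2 B; have [G1 [a1 [p1 i1 c1 b1]]] := r1 B; have [G2 [a2 [p2 i2 c2 b2]]] := r2 B.
exists (G1 * G2)%type, (fun g w => (a1 g.1 w.1, a2 g.2 w.2)); split.
- by rewrite card_prod muln_gt0 p1.
- by move=> g [x y] [x' y'] [] /= /i1 -> /i2 ->.
- by move=> g C w BC; split; [apply: c1 | apply: c2].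
move=> w w'; have [h1 [k1 k1h h1k] e1] := b1 w.1 w'.1; have [h2 [k2 k2h h2k] e2] := b2 w.2 w'.2.
exists (fun g => (h1 g.1, h2 g.2)); last by move=> g; split; [apply: e1 | apply: e2].
by exists (fun g => (k1 g.1, k2 g.2)) => -[x y] /=; rewrite ?k1h ?k2h ?h1k ?h2k.
Qed.

(** * Uniformly random orders *)

Lemma order_matching_perm (X : finType) (B : {set X}) (f g : X -> nat) :
    injective f -> injective g ->
  exists2 s : {perm X}, perm_on B s &
    forall x y, x \in B -> y \in B -> (f (s x) <= f (s y)) = (g x <= g y).
Proof.
move=> fI gI.
pose le (h : X -> nat) := relpre h leq.
pose l h := sort (le h) (enum B).
have tot h : total (le h) by move=> x y; apply: leq_total.
have tr h : transitive (le h) by move=> y x z; apply: leq_trans.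
have meml h x : (x \in l h) = (x \in B) by rewrite mem_sort mem_enum.
have uql h : uniq (l h) by rewrite sort_uniq enum_uniq.
have szl h : size (l h) = #|B| by rewrite size_sort -cardE.
have cmp h x0 i j : injective h -> i < #|B| -> j < #|B| ->
    (h (nth x0 (l h) i) <= h (nth x0 (l h) j)) = (i <= j).
  move=> hI iB jB.
  have mono a b : a < #|B| -> b < #|B| -> a <= b ->
      h (nth x0 (l h) a) <= h (nth x0 (l h) b).
    move=> aB bB ab; apply: (sorted_leq_nth (tr h) _ x0 (sort_sorted (tot h) (enum B))) => //.
    - by move=> x; apply: leqnn.
    - by rewrite inE szl.
    - by rewrite inE szl.
  apply/idP/idP => [H|]; last exact: mono.
  rewrite leqNgt; apply/negP => ji.
  have e : h (nth x0 (l h) i) = h (nth x0 (l h) j).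
    by apply/eqP; rewrite eqn_leq H mono // ltnW.
  move/hI/eqP: e; rewrite nth_uniq ?szl // => /eqP e.
  by rewrite e ltnn in ji.
pose s0 x := if x \in B then nth x (l f) (index x (l g)) else x.
have idx x : x \in B -> index x (l g) < #|B| by rewrite -(meml g) -index_mem szl.
have s0B x : x \in B -> s0 x \in B.
  by move=> xB; rewrite /s0 xB -(meml f) mem_nth // szl idx.
have s0I : injective s0.
  move=> x y; rewrite /s0.
  case: (boolP (x \in B)) => xB; case: (boolP (y \in B)) => yB //.
  - rewrite (set_nth_default x y) ?szl ?idx // => /eqP.
    rewrite nth_uniq ?szl ?idx // => /eqP e.
    have : nth x (l g) (index x (l g)) = nth x (l g) (index y (l g)) by rewrite e.
    by rewrite !nth_index ?meml.
  - by move=> e; have := s0B _ xB; rewrite /s0 xB e (negPf yB).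
  - by move=> e; have := s0B _ yB; rewrite /s0 yB -e (negPf xB).
exists (perm s0I).
  by apply/subsetP => x; rewrite inE permE /s0; case: (x \in B); rewrite ?eqxx.
move=> x y xB yB; rewrite !permE /s0 xB yB.
rewrite (set_nth_default x y) ?szl ?idx // cmp ?idx //.
have nx z : z \in B -> g z = g (nth x (l g) (index z (l g))) by move=> zB; rewrite nth_index ?meml.
by rewrite (nx x) // (nx y) // cmp ?idx.
Qed.

Section RandomOrder.
Variable X : finType.
Implicit Types (w : {perm X}) (W : {set X}) (Y : {set {perm X}}).

Definition before w x y : bool := (enum_rank (w x) <= enum_rank (w y))%N.

Lemma before_anti w x y : before w x y -> before w y x -> x = y.
Proof.
rewrite /before => h1 h2; apply: (@perm_inj _ w); apply: enum_rank_inj.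
by apply/eqP; rewrite -val_eqE /= eqn_leq h1.
Qed.

Lemma before_total w x y : before w x y || before w y x.
Proof. exact: leq_total. Qed.

Lemma before_trans w y x z : before w x y -> before w y z -> before w x z.
Proof. exact: leq_trans. Qed.

Definition first x W : {set {perm X}} :=
  [set w | (x \in W) && [forall y in W, before w x y]].

Lemma firstP x W w :
  reflect (x \in W /\ forall y, y \in W -> before w x y) (w \in first x W).
Proof.
rewrite inE; apply: (iffP andP) => -[xW H]; split=> //.
  by move=> y yW; move/forall_inP: H; apply.
by apply/forall_inP.
Qed.

Definition exchangeable W Y :=
  forall w x y, x \in W -> y \in W -> w \in Y -> (tperm x y * w)%g \in Y.

Lemma exchangeableT W : exchangeable W setT.
Proof. by move=> *; rewrite inE. Qed.

Lemma exchangeableS W W' Y : W' \subset W -> exchangeable W Y -> exchangeable W' Y.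
Proof. by move=> /subsetP s H w x y /s xW /s yW; apply: H. Qed.

Lemma first_exchangeable x W W' Y :
    x \notin W' -> W' \subset W -> exchangeable W' Y ->
  exchangeable W' (Y :&: first x W).
Proof.
move=> xW' /subsetP s HY w y z yW zW /setIP[wY /firstP[xW H]].
apply/setIP; split; first exact: HY.
apply/firstP; split=> // t tW; rewrite /before !permM tpermD.
- have := H (tperm y z t); rewrite /before; apply.
  by case: tpermP => [_|_|//]; apply: s.
- by apply: contraNneq xW' => <-.
- by apply: contraNneq xW' => <-.
Qed.

Lemma first_ex w W x : x \in W -> exists2 y, y \in W & w \in first y W.
Proof.
move=> xW; have [y yW H] := arg_minnP (fun z => nat_of_ord (enum_rank (w z))) xW.
by exists y => //; apply/firstP; split.
Qed.

Lemma card_first x W Y :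
  x \in W -> exchangeable W Y -> (#|Y :&: first x W| * #|W| = #|Y|)%N.
Proof.
move=> xW HY.
have same y : y \in W -> #|Y :&: first y W| = #|Y :&: first x W|.
  move=> yW; rewrite -(card_imset (Y :&: first x W) (f := fun w => (tperm x y * w)%g)); last first.
    exact: mulgI.
  have tp z : z \in W -> tperm x y z \in W by case: tpermP => [_|_|].
  apply: eq_card => w; apply/idP/imsetP => [/setIP[wY /firstP[_ H]]|].
    exists (tperm x y * w)%g; last by rewrite mulgA tperm2 mul1g.
    apply/setIP; split; first exact: HY.
    by apply/firstP; split=> // z zW; rewrite /before !permM tpermL; apply: H; apply: tp.
  case=> v /setIP[vY /firstP[_ H]] ->; apply/setIP; split; first exact: HY.
  by apply/firstP; split=> // z zW; rewrite /before !permM tpermR; apply: H; apply: tp.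
have -> : #|Y| = \sum_(y in W) #|Y :&: first y W|.
  transitivity (\sum_(w in Y) \sum_(y in W) (w \in first y W : nat)).
    rewrite -sum1_card; apply: eq_bigr => w _.
    have [y yW wy] := first_ex w xW.
    rewrite (bigD1 y) //= wy big1 // => z /andP[zW zy].
    apply/eqP; rewrite eqb0; apply: contraNN zy => /firstP[_ Hz].
    case/firstP: wy => _ Hy; apply/eqP; apply: (@before_anti w); [exact: Hz | exact: Hy].
  rewrite exchange_big /=; apply: eq_bigr => y _.
  rewrite -sum1_card big_mkcond [RHS]big_mkcond /=; apply: eq_bigr => w _.
  by rewrite in_setI; case: (w \in Y); case: (_ \in first _ _).
by rewrite (eq_bigr (fun=> #|Y :&: first x W|)) // sum_nat_const mulnC.
Qed.

Local Open Scope ring_scope.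
Variable R : realFieldType.

Definition prob (Omega : finType) (Y : {set Omega}) : R := #|Y|%:R / #|Omega|%:R.

Lemma card_perm_neq0 : #|{perm X}|%:R != 0 :> R.
Proof. by rewrite pnatr_eq0 -lt0n; apply/card_gt0P; exists 1%g. Qed.

Lemma prob_first x W Y :
  x \in W -> exchangeable W Y -> prob (Y :&: first x W) = prob Y / #|W|%:R.
Proof.
move=> xW HY; have W0 : #|W|%:R != 0 :> R.
  by rewrite pnatr_eq0 -lt0n; apply/card_gt0P; exists x.
rewrite /prob -(card_first xW HY) natrM; field.
by rewrite W0 card_perm_neq0.
Qed.

Lemma prob_first2 x y W1 W2 Y :
    x \in W1 -> x \notin W2 -> y \in W2 -> y \notin W1 ->
    exchangeable (W1 :|: W2) Y ->
  prob (Y :&: first x W1 :&: first y W2) =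
  prob Y / #|W1 :|: W2|%:R * (#|W1|%:R^-1 + #|W2|%:R^-1).
Proof.
move=> xW1 xW2 yW2 yW1 HY; set U := W1 :|: W2.
have xU : x \in U by rewrite inE xW1.
have yU : y \in U by rewrite inE yW2 orbT.
have split : Y :&: first x W1 :&: first y W2 =
    (Y :&: first x U :&: first y W2) :|: (Y :&: first y U :&: first x W1).
  apply/setP => w; rewrite !in_setU !in_setI; case: (w \in Y) => //=.
  apply/andP/orP => [[/firstP[_ Hx] /firstP[_ Hy]]|].
    case/orP: (before_total w x y) => xy; [left|right]; apply/andP; split;
      apply/firstP; split=> // z.
      by case/setUP => [/Hx //|/Hy]; apply: before_trans xy.
    by case/setUP => [/Hx|/Hy //]; apply: before_trans xy.
  case=> /andP[/firstP[_ H] /firstP[_ H']]; split; apply/firstP; split=> //.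
  - by move=> z zW; apply: H; rewrite inE zW.
  - by move=> z zW; apply: H; rewrite inE zW orbT.
have dis : (Y :&: first x U :&: first y W2) :&: (Y :&: first y U :&: first x W1) = set0.
  apply/setP => w; rewrite !in_setI in_set0; apply/negP.
  case/andP=> /andP[/andP[_ /firstP[_ Hx]] _] /andP[/andP[_ /firstP[_ Hy]] _].
  have e := before_anti (Hx y yU) (Hy x xU).
  by rewrite e yW2 in xW2.
have s1 : W1 \subset U by apply: subsetUl.
have s2 : W2 \subset U by apply: subsetUr.
have -> : prob (Y :&: first x W1 :&: first y W2) =
    prob (Y :&: first x U :&: first y W2) + prob (Y :&: first y U :&: first x W1).
  by rewrite /prob split cardsU dis cards0 subn0 natrD mulrDl.
rewrite !prob_first //.
- by rewrite mulrDr addrC.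
- by apply: first_exchangeable => //; apply: exchangeableS HY.
- by apply: first_exchangeable => //; apply: exchangeableS HY.
Qed.

Lemma prob_first3 x y z W1 W2 W3 :
    x \in W1 -> x \notin W2 -> x \notin W3 ->
    y \in W2 -> y \notin W1 -> y \notin W3 ->
    z \in W3 -> z \notin W1 -> z \notin W2 ->
  prob (first x W1 :&: first y W2 :&: first z W3) =
  #|W1 :|: W2 :|: W3|%:R^-1 *
    (#|W2 :|: W3|%:R^-1 * (#|W2|%:R^-1 + #|W3|%:R^-1) +
     #|W1 :|: W3|%:R^-1 * (#|W1|%:R^-1 + #|W3|%:R^-1) +
     #|W1 :|: W2|%:R^-1 * (#|W1|%:R^-1 + #|W2|%:R^-1)).
Proof.
move=> x1 x2 x3 y2 y1 y3 z3 z1 z2; set U := W1 :|: W2 :|: W3.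
have xU : x \in U by rewrite !inE x1.
have yU : y \in U by rewrite !inE y2 orbT.
have zU : z \in U by rewrite !inE z3 orbT.
have split : first x W1 :&: first y W2 :&: first z W3 =
    (first x U :&: first y W2 :&: first z W3) :|:
    ((first y U :&: first x W1 :&: first z W3) :|:
     (first z U :&: first x W1 :&: first y W2)).
  apply/setP => w; rewrite !in_setU !in_setI.
  apply/andP/idP => [[/andP[H1 H2] H3]|].
    have [t tU wt] := first_ex w xU.
    case/setUP: (tU) => [/setUP[tW|tW]|tW].
    - have -> : x = t.
        case/firstP: wt => _ Ht; case/firstP: H1 => _ Hx.
        by apply: (@before_anti w); [exact: Hx | exact: Ht].
      by rewrite wt H2 H3.
    - have -> : y = t.
        case/firstP: wt => _ Ht; case/firstP: H2 => _ Hx.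
        by apply: (@before_anti w); [exact: Hx | exact: Ht].
      by rewrite wt H1 H3 orbT.
    - have -> : z = t.
        case/firstP: wt => _ Ht; case/firstP: H3 => _ Hx.
        by apply: (@before_anti w); [exact: Hx | exact: Ht].
      by rewrite wt H1 H2 !orbT.
  have sub t W : t \in W -> W \subset U -> w \in first t U -> w \in first t W.
    by move=> tW /subsetP s /firstP[_ H]; apply/firstP; split=> // v /s; apply: H.
  case/orP => [/andP[/andP[H ->] ->]|/orP[/andP[/andP[H ->] ->]|/andP[/andP[H ->] ->]]];
    rewrite ?andbT //.
  - by split=> //; apply: sub H => //; rewrite /U -setUA subsetUl.
  - by split=> //; apply: sub H => //; rewrite /U setUAC subsetUr.
  - by split=> //; apply: sub H => //; rewrite subsetUr.
have dis s t A B : s \in U -> t \in U -> s != t ->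
    [disjoint first s U :&: A & first t U :&: B].
  move=> sU tU st; rewrite -setI_eq0; apply/eqP/setP => w; rewrite !in_setI in_set0.
  apply/negP => /andP[/andP[/firstP[_ Hs] _] /andP[/firstP[_ Ht] _]].
  by move/eqP: st; apply; apply: (@before_anti w); [exact: Hs | exact: Ht].
have xy : x != y by apply: contraNneq x2 => ->.
have xz : x != z by apply: contraNneq x3 => ->.
have yz : y != z by apply: contraNneq y3 => ->.
have probU (A B : {set {perm X}}) : [disjoint A & B] -> prob (A :|: B) = prob A + prob B :> R.
  by move=> d; rewrite /prob cardsU disjoint_setI0 // cards0 subn0 natrD mulrDl.
rewrite split probU; last first.
  by rewrite -!setIA -setI_eq0 setIUr setU_eq0 !setI_eq0 !dis.
rewrite probU; last by rewrite -!setIA; apply: dis.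
have pU t : t \in U -> prob (first t U) = #|U|%:R^-1.
  move=> tU; rewrite -(setTI (first t U)) prob_first //; last exact: exchangeableT.
  by rewrite /prob cardsT divff ?card_perm_neq0 // mul1r.
have ex t W : t \in U -> t \notin W -> W \subset U -> exchangeable W (first t U).
  move=> tU tW s; rewrite -(setTI (first t U)).
  by apply: first_exchangeable => //; apply: exchangeableT.
rewrite !prob_first2 ?pU //.
- ring.
- by apply: ex => //; [rewrite in_setU negb_or z1 | rewrite subsetUl].
- by apply: ex => //; [rewrite in_setU negb_or y1 | rewrite /U setUAC subsetUl].
- by apply: ex => //; [rewrite in_setU negb_or x2 | rewrite /U -setUA subsetUr].
Qed.

End RandomOrder.

Lemma resamplable_perm (E J : finType) :
  resamplable (fun (B : {set E}) (w w' : {perm E * J}) =>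
    forall x y, x.1 \in B -> y.1 \in B -> before w x y = before w' x y).
Proof.
move=> B; pose B' : {set E * J} := [set x | x.1 \in B].
exists {s : {perm E * J} | perm_on B' s}, (fun s w => (val s * w)%g); split.
- by apply/card_gt0P; exists (exist _ 1%g (perm_on1 _)).
- by move=> s w w' /mulgI.
- move=> s C w BC x y xC yC; rewrite /before !permM.
  have fx z : z.1 \in C -> val s z = z.
    move=> zC; apply: (out_perm (valP s)); rewrite inE.
    by rewrite (disjointFl BC).
  by rewrite !fx.
move=> w w'.
have [p pB Hp] := @order_matching_perm _ B' (fun x => enum_rank (w' x)) (fun x => enum_rank (w x))
  (fun x y e => perm_inj (enum_rank_inj (val_inj e)))
  (fun x y e => perm_inj (enum_rank_inj (val_inj e))).
exists (fun s => exist _ (val s * p)%g (perm_onM (valP s) pB)).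
  by apply: injF_bij => s t /(congr1 val) /= /mulIg /val_inj.
move=> s x y xB yB; rewrite /before /= !permM Hp //.
  by rewrite (perm_closed _ (valP s)) inE.
by rewrite (perm_closed _ (valP s)) inE.
Qed.

(** * One lottery round *)

Local Open Scope ring_scope.

(* With the three set sizes scaled to 1, u, v, w are the sizes of the pairwise
   unions and U the size of the triple union. *)
Lemma union_size_ineq (R : realFieldType) (u v w U : R) :
    1 <= u <= 2 -> 1 <= v <= 2 -> 1 <= w <= 2 ->
    u <= U -> v <= U -> w <= U -> u + v + w - 3 <= U ->
  8 <= (u^-1 + v^-1 + w^-1) * (6 - 2 / U).
Proof.
move=> /andP[u1 u2] /andP[v1 v2] /andP[w1 w2] uU vU wU sU.
set S := u + v + w.
have S3 : 3 <= S by rewrite /S; lra.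
have hS : 9 / S <= u^-1 + v^-1 + w^-1.
  rewrite ler_pdivrMr; last by lra.
  have e : (u^-1 + v^-1 + w^-1) * S - 9 =
     (u - v) ^+ 2 / (u * v) + (u - w) ^+ 2 / (u * w) + (v - w) ^+ 2 / (v * w).
    by rewrite /S; field; rewrite !gt_eqF; lra.
  rewrite -subr_ge0 e !addr_ge0 // divr_ge0 ?sqr_ge0 // mulr_ge0; lra.
have U1 : 1 <= U by lra.
have h6 : 0 <= 6 - 2 / U.
  have : U^-1 <= 1 by rewrite invf_le1; lra.
  by lra.
apply: le_trans (ler_wpM2r h6 hS).
have -> : 9 / S * (6 - 2 / U) = (54 - 18 / U) / S by field; rewrite !gt_eqF; lra.
rewrite ler_pdivlMr; last by lra.
have hU : U * U^-1 = 1 by rewrite divff // gt_eqF //; lra.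
have iU : 0 <= U^-1 by rewrite invr_ge0; lra.
suff : 18 <= (54 - 8 * S) * U.
  move=> H; have : 18 * U^-1 <= (54 - 8 * S) * (U * U^-1) by rewrite mulrA ler_wpM2r.
  by rewrite hU; lra.
have S6 : S <= 6 by rewrite /S; lra.
have UsS : S <= 3 * U by rewrite /S; lra.
have UsS' : S - 3 <= U by rewrite /S; lra.
have [S45|S45] := leP S (9 / 2); nra.
Qed.

Section Mean.
Variables (R : realFieldType) (Omega : finType).

Definition mean (X : Omega -> R) : R := (\sum_w X w) / #|Omega|%:R.

Lemma le_mean X Y : (forall w, X w <= Y w) -> mean X <= mean Y.
Proof. by move=> XY; rewrite ler_wpM2r ?invr_ge0 // ler_sum. Qed.

Lemma meanD X Y : mean (fun w => X w + Y w) = mean X + mean Y.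
Proof. by rewrite /mean big_split mulrDl. Qed.

Lemma meanN X : mean (fun w => - X w) = - mean X.
Proof. by rewrite /mean sumrN mulNr. Qed.

Lemma mean_sum (I : Type) (r : seq I) (P : pred I) (X : I -> Omega -> R) :
  mean (fun w => \sum_(i <- r | P i) X i w) = \sum_(i <- r | P i) mean (X i).
Proof. by rewrite /mean exchange_big mulr_suml. Qed.

Lemma mean_prob (Y : {set Omega}) : mean (fun w => (w \in Y)%:R) = prob R Y.
Proof.
rewrite /mean /prob; congr (_ / _); rewrite -sum1_card natr_sum big_mkcond [RHS]big_mkcond /=.
by apply: eq_bigr => w _; case: (w \in Y).
Qed.

Lemma eq_mean X Y : X =1 Y -> mean X = mean Y.
Proof. by move=> e; rewrite /mean (eq_bigr Y). Qed.

Lemma mean_cst (c : R) : (0 < #|Omega|)%N -> mean (fun=> c) = c.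
Proof.
move=> O0; rewrite /mean sumr_const -[c *+ _]mulr_natr mulfK //.
by rewrite pnatr_eq0 -lt0n.
Qed.

End Mean.

Section Luby.
Variables (V E : finType) (vs : E -> {set V}).
Implicit Types (F : {set E}) (e f g h : E).

Definition star F v : {set E} := [set e in F | v \in vs e].
Definition inc e f : bool := vs e :&: vs f != set0.
Definition nbr F e : {set E} := [set f in F | inc e f].

Lemma incC e f : inc e f = inc f e.
Proof. by rewrite /inc setIC. Qed.

Lemma incP e f : reflect (exists2 v, v \in vs e & v \in vs f) (inc e f).
Proof.
apply: (iffP (set0Pn _)) => [[v /setIP[ve vf]]|[v ve vf]]; exists v => //.
exact/setIP.
Qed.

Variables (F : {set E}) (n : nat).
Hypothesis ne : forall e, vs e != set0.
Hypothesis n0 : (0 < n)%N.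
Hypothesis nbrn : forall e, e \in F -> (#|nbr F e| <= n)%N.

Lemma inc_refl e : inc e e.
Proof. by rewrite /inc setIid. Qed.

(* The tickets (f, j) with j > 0 are private to f; they pad the competition of
   every edge to exactly n tickets, so that every edge wins with probability
   exactly 1/n. *)
Definition tickets f : {set E * 'I_n.+1} :=
  [set x | (x.2 == ord0) && (x.1 \in nbr F f) ||
           (x.1 == f) && (0 < x.2 <= n - #|nbr F f|)%N].

Definition luby (w : {perm E * 'I_n.+1}) : {set E} :=
  [set f in F | w \in first (f, ord0) (tickets f)].

Lemma card_tickets f : f \in F -> #|tickets f| = n.
Proof.
move=> fF.
pose T0 : {set E * 'I_n.+1} := setX (nbr F f) [set ord0].
pose J : {set 'I_n.+1} := [set j : 'I_n.+1 | (0 < j <= n - #|nbr F f|)%N].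
have -> : tickets f = T0 :|: setX [set f] J.
  by apply/setP => -[g j]; rewrite !inE /= andbC.
rewrite cardsU !cardsX !cards1 muln1 mul1n.
have -> : T0 :&: setX [set f] J = set0.
  apply/setP => -[g j]; rewrite !inE /=.
  by case: (j =P ord0) => [->|]; rewrite ?andbF.
rewrite cards0 subn0.
have -> : #|J| = (n - #|nbr F f|)%N.
  have -> : J = [set lift ord0 j | j : 'I_n in [pred j : 'I_n | (j < n - #|nbr F f|)%N]].
    apply/setP => j; rewrite inE; apply/idP/imsetP => [/andP[j0 jn]|[i]].
      case: (unliftP ord0 j) => [i ji|j00]; last by rewrite j00 in j0.
      by exists i => //; rewrite inE; move: jn; rewrite ji /= /bump.
    by rewrite inE => ilt ->; rewrite /= /bump.
  rewrite card_imset; last exact: lift_inj.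
  rewrite -[RHS]card_ord -[RHS](card_imset _ (f := widen_ord (leq_subr #|nbr F f| n))); last first.
    by move=> i j /(congr1 val) /= /val_inj.
  apply: eq_card => i; rewrite inE; apply/idP/imsetP => [ilt|[j _ ->]]; last by rewrite /=.
  by exists (Ordinal ilt) => //; apply: val_inj.
by rewrite subnKC // nbrn.
Qed.

Lemma mem_tickets f g : f \in F -> ((f, ord0) \in tickets g) = inc g f.
Proof. by move=> fF; rewrite !inE /= fF andbF orbF. Qed.

Lemma mem_luby w f :
  (f \in luby w) = (f \in F) && (w \in first (f, ord0) (tickets f)).
Proof. by rewrite in_set. Qed.

Lemma luby_indep w f g : f \in luby w -> g \in luby w -> inc f g -> f = g.
Proof.
rewrite !mem_luby => /andP[fF /firstP[_ Hf]] /andP[gF /firstP[_ Hg]] fg.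
have h1 := Hf (g, ord0); have h2 := Hg (f, ord0).
rewrite mem_tickets // fg in h1; rewrite mem_tickets // incC fg in h2.
by have [] := before_anti (h1 isT) (h2 isT).
Qed.

Lemma luby_sub w : luby w \subset F.
Proof. by apply/subsetP => f; rewrite mem_luby => /andP[]. Qed.

Variable R : realFieldType.

Definition win f (w : {perm E * 'I_n.+1}) : R := (f \in luby w)%:R.
Definition win1 f : R := mean (win f).
Definition win2 f g : R := mean (fun w => win f w * win g w).
Definition win3 f g h : R := mean (fun w => win f w * win g w * win h w).
Definition apart f g : R := (~~ inc f g)%:R.

Lemma win1E f : f \in F -> win1 f = n%:R^-1.
Proof.
move=> fF; rewrite /win1.
rewrite (eq_mean (Y := fun w => (w \in setT :&: first (f, ord0) (tickets f))%:R)); last first.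
  by move=> w; rewrite /win setTI mem_luby fF.
rewrite mean_prob prob_first ?card_tickets //; last exact: exchangeableT.
  by rewrite /prob cardsT divff ?card_perm_neq0 // mul1r.
by rewrite mem_tickets // inc_refl.
Qed.

Lemma win2E f g : f \in F -> g \in F -> ~~ inc f g ->
  win2 f g = 2 / (n%:R * #|tickets f :|: tickets g|%:R).
Proof.
move=> fF gF fg; rewrite /win2.
rewrite (eq_mean (Y := fun w => (w \in setT :&: first (f, ord0) (tickets f) :&:
    first (g, ord0) (tickets g))%:R)); last first.
  by move=> w; rewrite /win setTI !mem_luby fF gF in_setI -natrM mulnb.
rewrite mean_prob prob_first2 ?mem_tickets ?inc_refl //; last exact: exchangeableT.
- rewrite !card_tickets // /prob cardsT divff ?card_perm_neq0 // mul1r.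
  by rewrite invfM -mulr2n mulr_natl mulrnAr -mulrnAr mulrC mulrnAl.
- by rewrite incC.
Qed.

Lemma win3E f g h : f \in F -> g \in F -> h \in F ->
    ~~ inc f g -> ~~ inc f h -> ~~ inc g h ->
  win3 f g h = 2 / (n%:R * #|tickets f :|: tickets g :|: tickets h|%:R) *
    (#|tickets f :|: tickets g|%:R^-1 + #|tickets f :|: tickets h|%:R^-1 +
     #|tickets g :|: tickets h|%:R^-1).
Proof.
move=> fF gF hF fg fh gh; rewrite /win3.
rewrite (eq_mean (Y := fun w => (w \in first (f, ord0) (tickets f) :&:
    first (g, ord0) (tickets g) :&: first (h, ord0) (tickets h))%:R)); last first.
  by move=> w; rewrite /win !mem_luby fF gF hF !in_setI -!natrM !mulnb.
rewrite mean_prob prob_first3 ?mem_tickets ?inc_refl // 1?incC //.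
by rewrite !card_tickets // invfM; ring.
Qed.

Lemma win2_inc f g : f != g -> inc f g -> win2 f g = 0.
Proof.
move=> fg i; rewrite /win2 (eq_mean (Y := fun=> 0)); last first.
  move=> w; rewrite /win -natrM mulnb; case: andP => // -[/luby_indep H /H{}H].
  by rewrite H // eqxx in fg.
by rewrite /mean big1 ?mul0r.
Qed.

Lemma win2_ge0 f g : 0 <= win2 f g.
Proof. by rewrite divr_ge0 // sumr_ge0 // => w _; rewrite mulr_ge0. Qed.

Lemma win3_le_win2 f g h :
  (win3 f g h <= win2 f g) * (win3 f g h <= win2 f h) * (win3 f g h <= win2 g h).
Proof.
rewrite /win3 /win2; split; [split|]; apply: le_mean => w; rewrite /win -!natrM !mulnb ler_nat;
by do 3![case: (_ \in luby w)].
Qed.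

Let nR : 0 < n%:R :> R. Proof. by rewrite ltr0n. Qed.

Lemma card_tickets2 f g : f \in F -> g \in F ->
  ((n%:R : R) <= #|tickets f :|: tickets g|%:R) &&
  (#|tickets f :|: tickets g|%:R <= 2 * n%:R :> R).
Proof.
move=> fF gF; rewrite -natrM !ler_nat.
have := leq_card_setU (tickets f) (tickets g).
have := subset_leq_card (subsetUl (tickets f) (tickets g)).
by rewrite !card_tickets // => -> [+ _]; rewrite mul2n -addnn.
Qed.

Lemma win2_ge f g : f \in F -> g \in F -> f != g -> apart f g / n%:R ^+ 2 <= win2 f g.
Proof.
move=> fF gF fg; rewrite /apart; case: (boolP (inc f g)) => i /=.
  by rewrite mul0r win2_ge0.
rewrite win2E //; have /andP[u1 u2] := card_tickets2 fF gF.
move: u1 u2; set u := #|_|%:R; set N : R := n%:R => u1 u2.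
have uP : 0 < u by apply: lt_le_trans u1.
have -> : 2 / (N * u) = 1 / N ^+ 2 + (2 * N - u) / (N ^+ 2 * u).
  by field; rewrite !gt_eqF.
by rewrite lerDl divr_ge0 ?subr_ge0 // mulr_ge0 ?exprn_ge0 // ltW.
Qed.

Lemma win3_le f g h : f \in F -> g \in F -> h \in F -> f != g -> f != h -> g != h ->
  win3 f g h <= apart f g * apart f h * apart g h / n%:R ^+ 3 +
    3 / n%:R * ((win2 f g - apart f g / n%:R ^+ 2) + (win2 f h - apart f h / n%:R ^+ 2) +
                (win2 g h - apart g h / n%:R ^+ 2)).
Proof.
move=> fF gF hF fg fh gh.
have b1 := win2_ge fF gF fg; have b2 := win2_ge fF hF fh; have b3 := win2_ge gF hF gh.
case: (boolP [|| inc f g, inc f h | inc g h]) => [i|].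
  have -> : apart f g * apart f h * apart g h = 0.
    by rewrite /apart; case/or3P: i => ->; rewrite /= ?mulr0 ?mul0r ?mulr0 ?mul0r.
  have h0 : win3 f g h <= 0.
    case/or3P: i => /win2_inc.
    - by move=> /(_ fg) <-; apply: (win3_le_win2 _ _ _).1.1.
    - by move=> /(_ fh) <-; apply: (win3_le_win2 _ _ _).1.2.
    - by move=> /(_ gh) <-; apply: (win3_le_win2 _ _ _).2.
  apply: (le_trans h0); rewrite mul0r add0r mulr_ge0 ?divr_ge0 //.
  by lra.
rewrite !negb_or => /and3P[ifg ifh igh].
rewrite /apart ifg ifh igh /= !win2E // win3E // !mul1r.
have /andP[u1 u2] := card_tickets2 fF gF.
have /andP[v1 v2] := card_tickets2 fF hF.
have /andP[w1 w2] := card_tickets2 gF hF.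
have sU (A B : {set E * 'I_n.+1}) : A \subset B -> #|A|%:R <= #|B|%:R :> R.
  by move=> s; rewrite ler_nat subset_leq_card.
have uU := sU _ _ (subsetUl (tickets f :|: tickets g) (tickets h)).
have vU : #|tickets f :|: tickets h|%:R <= #|tickets f :|: tickets g :|: tickets h|%:R :> R.
  by apply: sU; rewrite setUAC subsetUl.
have wU : #|tickets g :|: tickets h|%:R <= #|tickets f :|: tickets g :|: tickets h|%:R :> R.
  by apply: sU; rewrite -setUA subsetUr.
have iU : #|tickets f :|: tickets g|%:R + #|tickets f :|: tickets h|%:R +
    #|tickets g :|: tickets h|%:R <= #|tickets f :|: tickets g :|: tickets h|%:R + 3 * n%:R :> R.
  rewrite -natrM -!natrD ler_nat.
  have cI (A B : {set E * 'I_n.+1}) : (#|A :|: B| + #|A :&: B| = #|A| + #|B|)%N by exact: cardsUI.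
  have := cI (tickets f) (tickets g); have := cI (tickets f) (tickets h).
  have := cI (tickets g) (tickets h).
  have := cI (tickets f :|: tickets g) (tickets h).
  have := cI (tickets f :&: tickets h) (tickets g :&: tickets h).
  rewrite -setIUl !card_tickets //.
  have := subset_leq_card (subsetIl (tickets f :&: tickets h) (tickets g :&: tickets h)).
  have : (#|tickets f :&: tickets h :&: (tickets g :&: tickets h)| <= #|tickets f :&: tickets g|)%N.
    by apply: subset_leq_card; rewrite setIACA subsetIl.
  repeat match goal with |- context [#|?S|] => move: #|S| => ? end.
  by clear; lia.
move: u1 u2 v1 v2 w1 w2 uU vU wU iU.
set u := #|_ :|: _|%:R; set v := #|tickets f :|: tickets h|%:R.
set w := #|tickets g :|: tickets h|%:R; set U := #|_ :|: tickets h|%:R.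
set N : R := n%:R => u1 u2 v1 v2 w1 w2 uU vU wU iU.
have sc x : N <= x -> x <= 2 * N -> 1 <= x / N <= 2.
  by move=> x1 x2; rewrite ler_pdivlMr // ler_pdivrMr // mul1r x1.
have := union_size_ineq (sc _ u1 u2) (sc _ v1 v2) (sc _ w1 w2) (U := U / N).
rewrite !ler_pM2r ?invr_gt0 // => /(_ uU vU wU).
have e3 : u / N + v / N + w / N - 3 = (u + v + w - 3 * N) / N by field; rewrite gt_eqF.
have lU : u + v + w - 3 * N <= U by lra.
rewrite e3 ler_pM2r ?invr_gt0 // => /(_ lU) K.
have u0 : 0 < u by apply: lt_le_trans u1.
have v0 : 0 < v by apply: lt_le_trans v1.
have w0 : 0 < w by apply: lt_le_trans w1.
have U0 : 0 < U by apply: lt_le_trans uU.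
rewrite -subr_ge0.
have -> : (N ^+ 3)^-1 + 3 / N * (2 / (N * u) - (N ^+ 2)^-1 + (2 / (N * v) - (N ^+ 2)^-1) +
   (2 / (N * w) - (N ^+ 2)^-1)) - 2 / (N * U) * (u^-1 + v^-1 + w^-1) =
   (((u / N)^-1 + (v / N)^-1 + (w / N)^-1) * (6 - 2 / (U / N)) - 8) / N ^+ 3.
  by field; rewrite !gt_eqF.
by rewrite divr_ge0 ?subr_ge0 // exprn_ge0 // ltW.
Qed.

End Luby.

(** * The probability that no neighbour wins *)

(* With a, b, c, p, q, t in {0, 1}, this is (1 - a)(1 - b)(1 - c) <= u when
   p = q = t = 0. *)
Lemma bonferroni_point (u a b c p q t z : nat) :
    (a + p + q <= 1 -> b + p + t <= 1 -> c + q + t <= 1 ->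
     0 < u + (a + b + c + p + q + t + z) ->
  1 + a * b + a * c + b * c + p * c + q * b + t * a <=
  u + (a + b + c + p + q + t + z) + a * b * c)%N.
Proof.
case: a => [|[|a]]; case: b => [|[|b]]; case: c => [|[|c]]; case: p => [|[|p]] //;
case: q => [|[|q]] //; case: t => [|[|t]] //; lia.
Qed.

Section Idle.
Variables (V E : finType) (vs : E -> {set V}) (F : {set E}) (n D : nat) (R : realFieldType).
Hypothesis ne : forall e, vs e != set0.
Hypothesis n0 : (0 < n)%N.
Hypothesis nbrn : forall e, e \in F -> (#|nbr vs F e| <= n)%N.
Hypothesis starD : forall v, (#|star vs F v| <= D)%N.
Hypothesis Dn : (3 * D <= n)%N.

Local Notation luby := (@luby V E vs F n).
Local Notation win1 := (@win1 V E vs F n R).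
Local Notation win2 := (@win2 V E vs F n R).
Local Notation win3 := (@win3 V E vs F n R).
Local Notation apart := (@apart V E vs R).

Definition idle e : R := mean (fun w => (luby w :&: nbr vs F e == set0)%:R).

Definition apart2 (A B : {set E}) : R := \sum_(f in A) \sum_(g in B) apart f g.
Definition apart3 (A B C : {set E}) : R :=
  \sum_(f in A) \sum_(g in B) \sum_(h in C) apart f g * apart f h * apart g h.

Let hits (A : {set E}) w : nat := (\sum_(f in luby w) (f \in A))%N.

Lemma hits_win (A : {set E}) w : (hits A w)%:R = \sum_(f in A) win vs F R f w.
Proof.
rewrite natr_sum big_mkcond [RHS]big_mkcond /=; apply: eq_bigr => f _; rewrite /win.
by case: (f \in luby w); case: (f \in A).
Qed.

Lemma hits_star v w : (hits (star vs F v) w <= 1)%N.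
Proof.
case: (pickP (fun f => (f \in luby w) && (f \in star vs F v))) => [f /andP[fl fv]|no].
  rewrite /hits (bigD1 f) //= fv big1 // => g /andP[gl gf]; apply/eqP.
  rewrite eqb0; apply: contraNN gf => gv; apply/eqP; apply: (luby_indep gl fl).
  by apply/incP; exists v; move: gv fv; rewrite !inE => /andP[_ ?] /andP[_ ?].
by rewrite /hits big1 // => f fl; have := no f; rewrite fl /= => ->.
Qed.

Lemma mean_hits (A : {set E}) : A \subset F -> mean (fun w => (hits A w)%:R) = #|A|%:R / n%:R :> R.
Proof.
move=> /subsetP AF; rewrite (eq_mean (hits_win A)) mean_sum.
rewrite (eq_bigr (fun=> n%:R^-1)) => [|f /AF fF]; last exact: win1E.
by rewrite sumr_const mulr_natl.
Qed.

Lemma mean_hits2 (A B : {set E}) : mean (fun w => (hits A w * hits B w)%N%:R) =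
  \sum_(f in A) \sum_(g in B) win2 f g.
Proof.
rewrite (eq_mean (Y := fun w => \sum_(f in A) \sum_(g in B) win vs F R f w * win vs F R g w)).
  by rewrite mean_sum; apply: eq_bigr => f _; rewrite mean_sum.
by move=> w; rewrite natrM !hits_win mulr_suml; apply: eq_bigr => f _; rewrite mulr_sumr.
Qed.

Lemma mean_hits3 (A B C : {set E}) : mean (fun w => (hits A w * hits B w * hits C w)%N%:R) =
  \sum_(f in A) \sum_(g in B) \sum_(h in C) win3 f g h.
Proof.
rewrite (eq_mean (Y := fun w => \sum_(f in A) \sum_(g in B) \sum_(h in C)
    win vs F R f w * win vs F R g w * win vs F R h w)).
  rewrite mean_sum; apply: eq_bigr => f _; rewrite mean_sum.
  by apply: eq_bigr => g _; rewrite mean_sum.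
move=> w; rewrite !natrM !hits_win mulr_suml mulr_suml; apply: eq_bigr => f _.
rewrite [win vs F R f w * _]mulr_sumr mulr_suml; apply: eq_bigr => g _.
by rewrite mulr_sumr.
Qed.

Lemma win2_sum_ge (A B : {set E}) : A \subset F -> B \subset F -> [disjoint A & B] ->
  apart2 A B / n%:R ^+ 2 <= \sum_(f in A) \sum_(g in B) win2 f g.
Proof.
move=> /subsetP AF /subsetP BF AB; rewrite mulr_suml; apply: ler_sum => f fA.
rewrite mulr_suml; apply: ler_sum => g gB; apply: (win2_ge ne n0 nbrn); [exact: AF | exact: BF |].
by apply: contraTneq gB => <-; rewrite (disjointFr AB).
Qed.

Lemma win3_sum_le (A B C : {set E}) :
    A \subset F -> B \subset F -> C \subset F ->
    (#|A| <= D)%N -> (#|B| <= D)%N -> (#|C| <= D)%N ->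
    [disjoint A & B] -> [disjoint A & C] -> [disjoint B & C] ->
  \sum_(f in A) \sum_(g in B) \sum_(h in C) win3 f g h <=
  apart3 A B C / n%:R ^+ 3 +
   ((\sum_(f in A) \sum_(g in B) win2 f g - apart2 A B / n%:R ^+ 2) +
    (\sum_(f in A) \sum_(h in C) win2 f h - apart2 A C / n%:R ^+ 2) +
    (\sum_(g in B) \sum_(h in C) win2 g h - apart2 B C / n%:R ^+ 2)).
Proof.
move=> AF BF CF cA cB cC AB AC BC.
move/subsetP: (AF) => AF'; move/subsetP: (BF) => BF'; move/subsetP: (CF) => CF'.
pose ex f g : R := win2 f g - apart f g / n%:R ^+ 2.
have exE (X Y : {set E}) : \sum_(f in X) \sum_(g in Y) win2 f g - apart2 X Y / n%:R ^+ 2 =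
    \sum_(f in X) \sum_(g in Y) ex f g.
  rewrite /apart2 mulr_suml -sumrB; apply: eq_bigr => f _.
  by rewrite mulr_suml -sumrB.
have ex0 (X Y : {set E}) : X \subset F -> Y \subset F -> [disjoint X & Y] ->
   0 <= \sum_(f in X) \sum_(g in Y) ex f g.
  by move=> XF YF XY; rewrite -exE subr_ge0 win2_sum_ge.
have nR : 0 < n%:R :> R by rewrite ltr0n.
have scale (m : nat) (x : R) : (m <= D)%N -> 0 <= x -> 3 / n%:R * (x *+ m) <= x.
  move=> mD x0; rewrite -[x *+ m]mulr_natr mulrC -mulrA ler_piMr // mulrA -natrM.
  by rewrite ler_pdivrMr // mul1r ler_nat; move: mD Dn; clear; lia.
apply: (@le_trans _ _ (apart3 A B C / n%:R ^+ 3 + 3 / n%:R *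
   ((\sum_(f in A) \sum_(g in B) ex f g) *+ #|C| +
    (\sum_(f in A) \sum_(h in C) ex f h) *+ #|B| +
    (\sum_(g in B) \sum_(h in C) ex g h) *+ #|A|))).
  have -> : (\sum_(f in A) \sum_(g in B) ex f g) *+ #|C| =
      \sum_(f in A) \sum_(g in B) \sum_(h in C) ex f g.
    rewrite -sumrMnl; apply: eq_bigr => f _; rewrite -sumrMnl; apply: eq_bigr => g _.
    by rewrite sumr_const.
  have -> : (\sum_(f in A) \sum_(h in C) ex f h) *+ #|B| =
      \sum_(f in A) \sum_(g in B) \sum_(h in C) ex f h.
    by rewrite -sumrMnl; apply: eq_bigr => f _; rewrite sumr_const.
  have -> : (\sum_(g in B) \sum_(h in C) ex g h) *+ #|A| =
      \sum_(f in A) \sum_(g in B) \sum_(h in C) ex g h.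
    by rewrite sumr_const.
  rewrite /apart3 mulr_suml -!big_split /= mulr_sumr -big_split /=; apply: ler_sum => f fA.
  rewrite mulr_suml -!big_split /= mulr_sumr -big_split /=; apply: ler_sum => g gB.
  rewrite mulr_suml -!big_split /= mulr_sumr -big_split /=; apply: ler_sum => h hC.
  apply: (win3_le ne n0 nbrn); [exact: AF' | exact: BF' | exact: CF' | | |].
  - by apply: contraTneq gB => <-; rewrite (disjointFr AB).
  - by apply: contraTneq hC => <-; rewrite (disjointFr AC).
  - by apply: contraTneq hC => <-; rewrite (disjointFr BC).
rewrite !exE lerD2l !mulrDr !lerD // scale ?ex0 //.
Qed.

Lemma idle_lower (e : E) (a b c : V) (A B C P Q T Z : {set E}) :
    (forall f, (f \in A) + (f \in P) + (f \in Q) <= (f \in star vs F a))%N ->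
    (forall f, (f \in B) + (f \in P) + (f \in T) <= (f \in star vs F b))%N ->
    (forall f, (f \in C) + (f \in Q) + (f \in T) <= (f \in star vs F c))%N ->
    (forall f, (f \in A) + (f \in B) + (f \in C) + (f \in P) + (f \in Q) + (f \in T) <= 1)%N ->
    Z \subset F ->
    (forall f, f \in nbr vs F e -> f \in A :|: B :|: C :|: P :|: Q :|: T :|: Z) ->
  1 - (#|A|%:R + #|B|%:R + #|C|%:R + #|P|%:R + #|Q|%:R + #|T|%:R + #|Z|%:R) / n%:R
   + (apart2 A B + apart2 A C + apart2 B C + apart2 P C + apart2 Q B + apart2 T A) / n%:R ^+ 2
   - apart3 A B C / n%:R ^+ 3 <= idle e.
Proof.
move=> ha hb hc hd ZF cov.
have point w : (1 + hits A w * hits B w + hits A w * hits C w + hits B w * hits C w +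
     hits P w * hits C w + hits Q w * hits B w + hits T w * hits A w <=
   (luby w :&: nbr vs F e == set0) + (hits A w + hits B w + hits C w + hits P w +
     hits Q w + hits T w + hits Z w) + hits A w * hits B w * hits C w)%N.
  have sum3 (X Y W S : {set E}) : (forall f, (f \in X) + (f \in Y) + (f \in W) <= (f \in S))%N ->
      (hits X w + hits Y w + hits W w <= hits S w)%N.
    by move=> H; rewrite /hits -!big_split /=; apply: leq_sum.
  apply: bonferroni_point; [exact: leq_trans (sum3 _ _ _ _ ha) (hits_star a w)
    | exact: leq_trans (sum3 _ _ _ _ hb) (hits_star b w)
    | exact: leq_trans (sum3 _ _ _ _ hc) (hits_star c w) |].
  case: (set_0Vmem (luby w :&: nbr vs F e)) => [->|[f /setIP[fl fN]]]; first by rewrite eqxx.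
  have hit (S : {set E}) : f \in S -> (0 < hits S w)%N.
    by move=> fS; rewrite /hits (bigD1 f) //= fS.
  rewrite addn_gt0; apply/orP; right.
  by move: (cov _ fN); rewrite !in_setU => /orP[/orP[/orP[/orP[/orP[/orP[]|]|]|]|]|] /hit;
    clear; lia.
have sub (S X Y : {set E}) v : (forall f, (f \in S) + (f \in X) + (f \in Y) <= (f \in star vs F v))%N ->
   [/\ S \subset star vs F v, X \subset star vs F v & Y \subset star vs F v].
  move=> H; split; apply/subsetP => f fS; have := H f; rewrite fS;
  by case: (f \in star vs F v) => //; rewrite ?addn1 ?add1n ?addnS ?addSn.
have starF v : star vs F v \subset F by apply/subsetP => f; rewrite inE => /andP[].
have [Aa Pa Qa] := sub _ _ _ _ ha; have [Bb Pb Tb] := sub _ _ _ _ hb.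
have [Cc Qc Tc] := sub _ _ _ _ hc.
have inF (S : {set E}) v : S \subset star vs F v -> S \subset F by move=> s; apply: subset_trans (starF v).
have inD (S : {set E}) v : S \subset star vs F v -> (#|S| <= D)%N.
  by move=> s; apply: leq_trans (starD v); apply: subset_leq_card.
have disj (X Y : {set E}) : (forall f, (f \in X) + (f \in Y) <= 1)%N -> [disjoint X & Y].
  move=> H; rewrite -setI_eq0; apply/eqP/setP => f; rewrite !inE; have := H f.
  by case: (f \in X); case: (f \in Y).
have dAB : [disjoint A & B] by apply: disj => f; move: (hd f); clear; lia.
have dAC : [disjoint A & C] by apply: disj => f; move: (hd f); clear; lia.
have dBC : [disjoint B & C] by apply: disj => f; move: (hd f); clear; lia.
have dPC : [disjoint P & C] by apply: disj => f; move: (hd f); clear; lia.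
have dQB : [disjoint Q & B] by apply: disj => f; move: (hd f); clear; lia.
have dTA : [disjoint T & A] by apply: disj => f; move: (hd f); clear; lia.
have AF := inF _ _ Aa; have BF := inF _ _ Bb; have CF := inF _ _ Cc.
have PF := inF _ _ Pa; have QF := inF _ _ Qa; have TF := inF _ _ Tb.
have : mean (fun w => 1 + (hits A w * hits B w)%N%:R + (hits A w * hits C w)%N%:R +
     (hits B w * hits C w)%N%:R + (hits P w * hits C w)%N%:R + (hits Q w * hits B w)%N%:R +
     (hits T w * hits A w)%N%:R) <=
   mean (fun w => (luby w :&: nbr vs F e == set0)%:R + ((hits A w)%:R + (hits B w)%:R +
     (hits C w)%:R + (hits P w)%:R + (hits Q w)%:R + (hits T w)%:R + (hits Z w)%:R) +
     (hits A w * hits B w * hits C w)%N%:R) :> R.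
  by apply: le_mean => w; have := point w; rewrite -(ler_nat R) !natrD.
rewrite !meanD !mean_hits // !mean_hits2 mean_hits3 mean_cst; last first.
  by apply/card_gt0P; exists 1%g.
rewrite -/(idle e).
have w3 := win3_sum_le AF BF CF (inD _ _ Aa) (inD _ _ Bb) (inD _ _ Cc) dAB dAC dBC.
have w1 := win2_sum_ge PF CF dPC; have w2 := win2_sum_ge QF BF dQB.
have w4 := win2_sum_ge TF AF dTA.
move=> H; rewrite !mulrDl; lra.
Qed.

End Idle.

(* Equality holds for A = B = C = s = 1, s12 = s13 = s23 = 1/3 and t = 1/9: the
   pairs and triples around an edge abc whose other neighbours run, in equal
   parts, through three vertices x, y, z. *)
Lemma pair_triple_ineq (R : realFieldType) (A B C p q r s12 s13 s23 t : R) :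
    0 <= p -> 0 <= q -> 0 <= r ->
    A + p + q <= 1 -> B + p + r <= 1 -> C + q + r <= 1 ->
    0 <= s12 -> 0 <= s13 -> 0 <= s23 ->
    s12 + s13 + s23 <= (A + B + C) / 3 -> t <= (s12 + s13 + s23) / 9 ->
  52 / 243 <= 1 - (A + B + C + p + q + r) / 3
    + (A * B + A * C + B * C - (s12 + s13 + s23) + p * C + q * B + r * A) / 9
    - (A * B * C - s12 * C - s13 * B - s23 * A + 2 * t) / 27.
Proof.
move=> p0 q0 r0; move: A B C.
suff H a b c : a >= p + q -> b >= p + r -> c >= q + r -> 0 <= s12 -> 0 <= s13 -> 0 <= s23 ->
    s12 + s13 + s23 <= 1 - (a + b + c) / 3 -> t <= (s12 + s13 + s23) / 9 ->
    0 <= 20 + 36 * (a + b + c) - 54 * (p + q + r) + 18 * (a * b + a * c + b * c) +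
      9 * (a * b * c) - 18 * (s12 + s13 + s23) - 27 * (p * c + q * b + r * a) -
      9 * (s12 * c + s13 * b + s23 * a) - 18 * t.
  move=> A B C h1 h2 h3 h4 h5 h6 h7 h8.
  have := H (1 - A) (1 - B) (1 - C); rewrite -subr_ge0.
  set X := (X in _ -> 0 <= X) => H'.
  have -> : X = (20 + 36 * (1 - A + (1 - B) + (1 - C)) - 54 * (p + q + r) +
      18 * ((1 - A) * (1 - B) + (1 - A) * (1 - C) + (1 - B) * (1 - C)) +
      9 * ((1 - A) * (1 - B) * (1 - C)) - 18 * (s12 + s13 + s23) -
      27 * (p * (1 - C) + q * (1 - B) + r * (1 - A)) -
      9 * (s12 * (1 - C) + s13 * (1 - B) + s23 * (1 - A)) - 18 * t) / 243.
    by rewrite /X; field.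
  by rewrite divr_ge0 // H' //; lra.
move=> ha hb hc s1 s2 s3 hs ht.
have a0 : 0 <= a by lra.
have b0 : 0 <= b by lra.
have c0 : 0 <= c by lra.
have T : p + q + r <= (a + b + c) / 2 by lra.
have e1 : p * c + q * b + r * a <= a * b + a * c + b * c.
  have : p * c <= (a + b) / 2 * c by rewrite ler_wpM2r //; lra.
  have : q * b <= (a + c) / 2 * b by rewrite ler_wpM2r //; lra.
  have : r * a <= (b + c) / 2 * a by rewrite ler_wpM2r //; lra.
  by lra.
have e2 : s12 * c + s13 * b + s23 * a <= (s12 + s13 + s23) * (a + b + c).
  have := mulr_ge0 s1 a0; have := mulr_ge0 s1 b0; have := mulr_ge0 s2 a0.
  have := mulr_ge0 s2 c0; have := mulr_ge0 s3 b0; have := mulr_ge0 s3 c0; lra.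
have e3 : (s12 + s13 + s23) * (20 + 9 * (a + b + c)) <=
    (1 - (a + b + c) / 3) * (20 + 9 * (a + b + c)) by rewrite ler_wpM2r //; lra.
have e4 := mulr_ge0 (mulr_ge0 a0 b0) c0.
have q1 := sqr_ge0 (a - b); have q2 := sqr_ge0 (a - c); have q3 := sqr_ge0 (b - c).
nra.
Qed.

Lemma pair_triple_scaled (R : realFieldType) (d kk z zc A B C p q r S12 S13 S23 T
    AB AC BC PC QB TA ABC : R) :
    0 < d -> 0 <= kk -> 0 <= A -> 0 <= B -> 0 <= C -> 0 <= p -> 0 <= q -> 0 <= r ->
    A + p + q <= d -> B + p + r <= d -> C + q + r <= d ->
    0 <= S12 -> 0 <= S13 -> 0 <= S23 ->
    S12 + S13 + S23 <= d * (A + B + C) / 3 -> T <= d * (S12 + S13 + S23) / 9 ->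
    zc <= z ->
    A * B - S12 - kk * (2 * A) <= AB -> A * C - S13 - kk * (2 * A) <= AC ->
    B * C - S23 - kk * (2 * B) <= BC ->
    p * C - 2 * d <= PC -> q * B - 2 * d <= QB -> r * A - 2 * d <= TA ->
    ABC <= A * B * C - C * S12 - B * S13 - A * S23 + 2 * T ->
  52 / 243 - (z / (3 * d) + (6 * kk + 6) / (9 * d)) <=
  1 - (A + B + C + p + q + r + zc) / (3 * d)
    + (AB + AC + BC + PC + QB + TA) / (3 * d) ^+ 2 - ABC / (3 * d) ^+ 3.
Proof.
move=> d0 k0 A0 B0 C0 p0 q0 r0 hA hB hC s12 s13 s23 hS hT hz hAB hAC hBC hPC hQB hTA hABC.
have dn : d != 0 by rewrite gt_eqF.
have id : 0 <= d^-1 by rewrite invr_ge0 ltW.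
have id2 : 0 <= (d ^+ 2)^-1 by rewrite invr_ge0 exprn_ge0 ?ltW.
have id3 : 0 <= (d ^+ 3)^-1 by rewrite invr_ge0 exprn_ge0 ?ltW.
have main := @pair_triple_ineq R (A / d) (B / d) (C / d) (p / d) (q / d) (r / d)
  (S12 / d ^+ 2) (S13 / d ^+ 2) (S23 / d ^+ 2) (T / d ^+ 3)
  (mulr_ge0 p0 id) (mulr_ge0 q0 id) (mulr_ge0 r0 id).
have sc x y w : x + y + w <= d -> x / d + y / d + w / d <= 1.
  by move=> h; rewrite -!mulrDl ler_pdivrMr // mul1r.
have {}main := main (sc _ _ _ hA) (sc _ _ _ hB) (sc _ _ _ hC)
  (mulr_ge0 s12 id2) (mulr_ge0 s13 id2) (mulr_ge0 s23 id2).
have hS' : S12 / d ^+ 2 + S13 / d ^+ 2 + S23 / d ^+ 2 <= (A / d + B / d + C / d) / 3.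
  rewrite -!mulrDl -subr_ge0.
  have -> : (A + B + C) / d / 3 - (S12 + S13 + S23) / d ^+ 2 =
     (d * (A + B + C) / 3 - (S12 + S13 + S23)) / d ^+ 2 by field.
  by rewrite mulr_ge0 // subr_ge0.
have hT' : T / d ^+ 3 <= (S12 / d ^+ 2 + S13 / d ^+ 2 + S23 / d ^+ 2) / 9.
  rewrite -!mulrDl -subr_ge0.
  have -> : (S12 + S13 + S23) / d ^+ 2 / 9 - T / d ^+ 3 =
     (d * (S12 + S13 + S23) / 9 - T) / d ^+ 3 by field.
  by rewrite mulr_ge0 // subr_ge0.
have {}main := main hS' hT'.
have h2 : A * B + A * C + B * C - (S12 + S13 + S23) + p * C + q * B + r * A - 6 * kk * d - 6 * d <=
    AB + AC + BC + PC + QB + TA.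
  have : kk * (2 * A) <= kk * (2 * d) by rewrite ler_wpM2l //; lra.
  have : kk * (2 * B) <= kk * (2 * d) by rewrite ler_wpM2l //; lra.
  by lra.
have := ler_wpM2r id2 h2; have := ler_wpM2r id3 hABC; have := ler_wpM2r id hz.
set ZC := zc / d; set Z := z / d; set X3 := ABC / d ^+ 3; set X2 := (AB + _ + _ + _ + _ + _) / d ^+ 2.
move=> f1 f3 f2.
have -> : 52 / 243 - (z / (3 * d) + (6 * kk + 6) / (9 * d)) =
   52 / 243 - Z / 3 - (6 * kk * d + 6 * d) / d ^+ 2 / 9 by rewrite /Z; field.
have -> : 1 - (A + B + C + p + q + r + zc) / (3 * d) + (AB + AC + BC + PC + QB + TA) / (3 * d) ^+ 2
    - ABC / (3 * d) ^+ 3 = 1 - (A + B + C + p + q + r) / d / 3 - ZC / 3 + X2 / 9 - X3 / 27.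
  by rewrite /ZC /X2 /X3; field.
have e2 : (A * B + A * C + B * C - (S12 + S13 + S23) + p * C + q * B + r * A - 6 * kk * d - 6 * d) / d ^+ 2
   = A / d * (B / d) + A / d * (C / d) + B / d * (C / d) - (S12 + S13 + S23) / d ^+ 2 +
     p / d * (C / d) + q / d * (B / d) + r / d * (A / d) - (6 * kk * d + 6 * d) / d ^+ 2.
  by field.
have e3 : (A * B * C - C * S12 - B * S13 - A * S23 + 2 * T) / d ^+ 3 =
   A / d * (B / d) * (C / d) - S12 / d ^+ 2 * (C / d) - S13 / d ^+ 2 * (B / d) -
   S23 / d ^+ 2 * (A / d) + 2 * (T / d ^+ 3) by field.
rewrite e2 in f2; rewrite e3 in f3; lra.
Qed.

Lemma card_sum3 (I : finType) (X Y W S : {set I}) :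
    (forall f, (f \in X) + (f \in Y) + (f \in W) <= (f \in S))%N ->
  (#|X| + #|Y| + #|W| <= #|S|)%N.
Proof.
have cE (A : {set I}) : #|A| = (\sum_f (f \in A))%N.
  by rewrite -sum1_card big_mkcond /=; apply: eq_bigr => f _; case: (f \in A).
by move=> H; rewrite !cE -!big_split /=; apply: leq_sum.
Qed.

Lemma card_bigcup_le (I T : finType) (A : {set I}) (G : I -> {set T}) (a b : nat) :
    (#|A| <= a)%N -> (forall i, i \in A -> #|G i| <= b)%N ->
  (#|\bigcup_(i in A) G i| <= a * b)%N.
Proof.
move=> Aa Gb; apply: (@leq_trans (#|A| * b)); last by rewrite leq_mul2r Aa orbT.
rewrite -sum_nat_const; elim/big_rec2: _ => [|i x y iA xy]; first by rewrite cards0.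
by rewrite (leq_trans (leq_card_setU _ _).1) // leq_add // Gb.
Qed.

Section Estimate.
Variables (V E : finType) (vs : E -> {set V}) (F : {set E}) (D k : nat) (R : realFieldType).
Hypothesis vs3 : forall e, #|vs e| = 3%N.
Hypothesis vsI : injective vs.
Hypothesis starD : forall v, (#|star vs F v| <= D)%N.

Lemma vs_neq0 e : vs e != set0.
Proof. by rewrite -card_gt0 vs3. Qed.

Lemma card_nbr e : (#|nbr vs F e| <= 3 * D)%N.
Proof.
have s : nbr vs F e \subset \bigcup_(v in vs e) star vs F v.
  apply/subsetP => f; rewrite inE => /andP[fF /incP[v ve vf]].
  by apply/bigcupP; exists v => //; rewrite inE fF.
apply: leq_trans (subset_leq_card s) _.
by apply: card_bigcup_le; rewrite ?vs3.
Qed.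

Definition mult (A : {set E}) x : R := #|[set f in A | x \in vs f]|%:R.

Lemma multE A x : mult A x = \sum_(f in A) (x \in vs f)%:R.
Proof.
rewrite /mult -sum1_card natr_sum big_mkcond [RHS]big_mkcond /=.
by apply: eq_bigr => f _; rewrite inE; case: (f \in A); case: (x \in vs f).
Qed.

Lemma sum_mult (A : {set E}) (X : {set V}) (m : nat) :
    (forall f, f \in A -> (#|vs f :&: X| <= m)%N) ->
  \sum_(x in X) mult A x <= m%:R * #|A|%:R.
Proof.
move=> H; rewrite (eq_bigr (fun x => \sum_(f in A) (x \in vs f)%:R)) => [|x _]; last exact: multE.
rewrite exchange_big /= mulr_natr -sumr_const; apply: ler_sum => f /H.
rewrite -(ler_nat R) -sum1_card natr_sum; apply: le_trans.
rewrite big_mkcond [leRHS]big_mkcond /=; apply: ler_sum => x _.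
by rewrite inE; case: (x \in X); case: (x \in vs f).
Qed.

Variable e : E.
Hypothesis eF : e \in F.

Lemma mult2E (X : {set V}) (A B : {set E}) :
  \sum_(x in X) mult A x * mult B x =
  \sum_(f in A) \sum_(g in B) \sum_(x in X) (x \in vs f)%:R * (x \in vs g)%:R.
Proof.
rewrite (eq_bigr (fun x => \sum_(f in A) \sum_(g in B) (x \in vs f)%:R * (x \in vs g)%:R)).
  by rewrite exchange_big; apply: eq_bigr => f _; rewrite exchange_big.
move=> x _; rewrite !multE mulr_suml; apply: eq_bigr => f _.
by rewrite mulr_sumr.
Qed.

Lemma mult3E (X : {set V}) (A B C : {set E}) :
  \sum_(x in X) mult A x * mult B x * mult C x =
  \sum_(f in A) \sum_(g in B) \sum_(h in C) \sum_(x in X)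
     (x \in vs f)%:R * (x \in vs g)%:R * (x \in vs h)%:R.
Proof.
rewrite (eq_bigr (fun x => \sum_(f in A) \sum_(g in B) \sum_(h in C)
    (x \in vs f)%:R * (x \in vs g)%:R * (x \in vs h)%:R)).
  rewrite exchange_big; apply: eq_bigr => f _; rewrite exchange_big; apply: eq_bigr => g _.
  by rewrite exchange_big.
move=> x _; rewrite !multE mulr_suml mulr_suml; apply: eq_bigr => f _.
rewrite [X in X * _]mulr_sumr mulr_suml; apply: eq_bigr => g _.
by rewrite mulr_sumr.
Qed.

Lemma apart2_lower (A B : {set E}) :
    (forall f g v, f \in A -> g \in B -> v \in vs f -> v \in vs g -> v \notin vs e) ->
  #|A|%:R * #|B|%:R - \sum_(x in ~: vs e) mult A x * mult B x <= apart2 vs R A B.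
Proof.
move=> H.
rewrite mult2E.
have -> : #|A|%:R * #|B|%:R = \sum_(f in A) \sum_(g in B) 1 :> R.
  by rewrite !sumr_const -[RHS]mulr_natl.
rewrite -sumrB; apply: ler_sum => f fA; rewrite -sumrB; apply: ler_sum => g gB.
rewrite /apart; case: (boolP (inc vs f g)) => [/incP[v vf vg]|_].
  rewrite subr_le0 (bigD1 v) /=; last by rewrite inE (H f g v).
  by rewrite vf vg mulr1 lerDl sumr_ge0 // => x _; rewrite mulr_ge0.
by rewrite gerBl sumr_ge0 // => x _; rewrite mulr_ge0.
Qed.

Definition weight x : nat := #|[set f in nbr vs F e | x \in vs f]|.
Definition heavy : {set V} := [set x | (x \notin vs e) && (k <= weight x)%N].

Lemma card_outer f : inc vs f e -> (#|vs f :&: ~: vs e| <= 2)%N.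
Proof.
by rewrite -setDE /inc -card_gt0 => h; have := cardsID (vs e) (vs f); rewrite vs3; lia.
Qed.

Lemma card_heavy : (#|heavy| * k <= 6 * D)%N.
Proof.
apply: (@leq_trans (2 * #|nbr vs F e|)); last by have := card_nbr e; lia.
rewrite -(ler_nat R) !natrM.
have H : \sum_(x in ~: vs e) mult (nbr vs F e) x <= 2%:R * #|nbr vs F e|%:R.
  by apply: sum_mult => f; rewrite inE => /andP[_ ?]; apply: card_outer; rewrite incC.
apply: le_trans H; rewrite mulrC mulr_natr -sumr_const.
rewrite [leLHS]big_mkcond [leRHS]big_mkcond /=; apply: ler_sum => x _.
rewrite !inE; case: (x \in vs e) => //=; case: leqP => //= kx; first by rewrite ler_nat.
Qed.

Lemma mult_outer (A B : {set E}) :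
    (forall f, f \in A -> inc vs f e) -> (forall f, f \in B -> f \in nbr vs F e) ->
    (forall f g v, f \in A -> g \in B -> v \in vs f -> v \in vs g -> v \notin vs e) ->
  #|A|%:R * #|B|%:R - \sum_(x in heavy) mult A x * mult B x - k%:R * (2 * #|A|%:R)
    <= apart2 vs R A B.
Proof.
move=> iA BN disj; apply: le_trans (apart2_lower disj).
have -> : \sum_(x in ~: vs e) mult A x * mult B x =
    \sum_(x in heavy) mult A x * mult B x +
    \sum_(x in ~: vs e :\: heavy) mult A x * mult B x.
  rewrite (big_setID heavy) /=; congr (_ + _); apply: eq_bigl => x.
  by rewrite !inE; case: (x \in vs e).
rewrite opprD addrA lerD2l lerN2.
apply: (@le_trans _ _ (k%:R * \sum_(x in ~: vs e) mult A x)).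
  rewrite mulr_sumr [leRHS](big_setID heavy) /= ler_wpDl //.
    by rewrite sumr_ge0 // => x _; rewrite mulr_ge0.
  apply: ler_sum => x; rewrite !inE negb_and negbK => /andP[xh xe].
  rewrite mulrC ler_wpM2r // ler_nat; move: xh; rewrite (negPf xe) /= -ltnNge => /ltnW.
  apply: leq_trans; apply: subset_leq_card; apply/subsetP => f; rewrite in_set => /andP[/BN fN xf].
  by rewrite in_set fN.
rewrite ler_wpM2l //; apply: sum_mult => f /iA; exact: card_outer.
Qed.

Lemma apart3_upper (A B C : {set E}) :
    (forall f, f \in A :|: B :|: C -> (#|vs f :&: heavy| <= 1)%N) ->
  apart3 vs R A B C <= #|A|%:R * #|B|%:R * #|C|%:R
    - #|C|%:R * (\sum_(x in heavy) mult A x * mult B x)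
    - #|B|%:R * (\sum_(x in heavy) mult A x * mult C x)
    - #|A|%:R * (\sum_(x in heavy) mult B x * mult C x)
    + 2 * (\sum_(x in heavy) mult A x * mult B x * mult C x).
Proof.
move=> H.
have -> : #|A|%:R * #|B|%:R * #|C|%:R = \sum_(f in A) \sum_(g in B) \sum_(h in C) 1 :> R.
  by rewrite !sumr_const -!mulrnA -!natrM mulnC [(#|A| * _)%N]mulnC mulnA.
have -> : #|C|%:R * (\sum_(x in heavy) mult A x * mult B x) =
    \sum_(f in A) \sum_(g in B) \sum_(h in C) \sum_(x in heavy) (x \in vs f)%:R * (x \in vs g)%:R.
  rewrite mult2E mulr_sumr; apply: eq_bigr => f _; rewrite mulr_sumr; apply: eq_bigr => g _.
  by rewrite sumr_const mulr_natl.
have -> : #|B|%:R * (\sum_(x in heavy) mult A x * mult C x) =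
    \sum_(f in A) \sum_(g in B) \sum_(h in C) \sum_(x in heavy) (x \in vs f)%:R * (x \in vs h)%:R.
  rewrite mult2E mulr_sumr; apply: eq_bigr => f _; rewrite [RHS]sumr_const.
  by rewrite mulr_natl.
have -> : #|A|%:R * (\sum_(x in heavy) mult B x * mult C x) =
    \sum_(f in A) \sum_(g in B) \sum_(h in C) \sum_(x in heavy) (x \in vs g)%:R * (x \in vs h)%:R.
  by rewrite mult2E [RHS]sumr_const mulr_natl.
rewrite mult3E mulr_sumr -!sumrB -big_split /=; apply: ler_sum => f fA.
rewrite mulr_sumr -!sumrB -big_split /=; apply: ler_sum => g gB.
rewrite mulr_sumr -!sumrB -big_split /=; apply: ler_sum => h hC.
have in2 (p q : E) : \sum_(x in heavy) (x \in vs p)%:R * (x \in vs q)%:R =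
    #|(vs p :&: heavy) :&: (vs q :&: heavy)|%:R :> R.
  rewrite -sum1_card natr_sum big_mkcond [RHS]big_mkcond /=; apply: eq_bigr => x _.
  by rewrite !in_setI; case: (x \in heavy); case: (x \in vs p); case: (x \in vs q) => /=; rewrite ?mulr0 ?mul0r ?mulr1.
have in3 (p q r : E) : \sum_(x in heavy) (x \in vs p)%:R * (x \in vs q)%:R * (x \in vs r)%:R =
    #|(vs p :&: heavy) :&: (vs q :&: heavy) :&: (vs r :&: heavy)|%:R :> R.
  rewrite -sum1_card natr_sum big_mkcond [RHS]big_mkcond /=; apply: eq_bigr => x _.
  by rewrite !in_setI; case: (x \in heavy); case: (x \in vs p); case: (x \in vs q);
    case: (x \in vs r) => /=; rewrite ?mulr0 ?mul0r ?mulr1.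
rewrite !in2 in3.
have X1 : (#|vs f :&: heavy| <= 1)%N by apply: H; rewrite !inE fA.
have Y1 : (#|vs g :&: heavy| <= 1)%N by apply: H; rewrite !inE gB orbT.
have Z1 : (#|vs h :&: heavy| <= 1)%N by apply: H; rewrite !inE hC orbT.
have iP (p q : E) : (~~ inc vs p q <= (#|(vs p :&: heavy) :&: (vs q :&: heavy)| == 0))%N.
  case: (boolP (inc vs p q)) => //= npq.
  rewrite lt0b cards_eq0 -subset0; move: npq; rewrite /inc negbK => /eqP <-.
  by rewrite setIACA subsetIl.
have tri (X Y Z : {set V}) : (#|X| <= 1 -> #|X :&: Y| + #|X :&: Z| <= 1 + #|X :&: Y :&: Z|)%N.
  move=> h1; rewrite -cardsUI -setIUr setIACA setIid setIA leq_add2r.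
  by apply: leq_trans h1; apply: subset_leq_card; apply: subsetIl.
move: X1 Y1 Z1 (iP f g) (iP f h) (iP g h) tri.
rewrite /apart -!natrM; set X := vs f :&: heavy; set Y := vs g :&: heavy; set Z := vs h :&: heavy.
move=> X1 Y1 Z1 i1 i2 i3 tri.
have t1 := tri X Y Z X1.
have t2 : (#|X :&: Y| + #|Y :&: Z| <= 1 + #|X :&: Y :&: Z|)%N.
  by rewrite [X :&: Y]setIC; apply: tri.
have t3 : (#|X :&: Z| + #|Y :&: Z| <= 1 + #|X :&: Y :&: Z|)%N.
  have -> : X :&: Y :&: Z = Z :&: X :&: Y by rewrite setIC setIA.
  by rewrite [X :&: Z]setIC [Y :&: Z]setIC; apply: tri.
have t4 : (#|X :&: Y :&: Z| <= 1)%N.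
  by apply: leq_trans X1; apply: subset_leq_card; rewrite -setIA subsetIl.
clear -i1 i2 i3 t1 t2 t3 t4.
have key : (~~ inc vs f g * ~~ inc vs f h * ~~ inc vs g h + (#|X :&: Y| + #|X :&: Z| + #|Y :&: Z|)
   <= 1 + 2 * #|X :&: Y :&: Z|)%N.
  clearbody X Y Z; move: i1 i2 i3 t1 t2 t3 t4.
  move: #|X :&: Y :&: Z| #|X :&: Y| #|X :&: Z| #|Y :&: Z| => t p12 p13 p23.
  case: (inc vs f g); case: (inc vs f h); case: (inc vs g h) => /=;
  case: p12 => [|p12]; case: p13 => [|p13]; case: p23 => [|p23] //=; lia.
move: key; rewrite -(ler_nat R) !natrD !natrM; lra.
Qed.

Definition crowded : {set E} := [set f in F | vs f \subset vs e :|: heavy].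

Lemma card_crowded : (#|crowded| <= 2 ^ (3 + #|heavy|))%N.
Proof.
rewrite -(card_imset crowded vsI).
apply: (@leq_trans #|powerset (vs e :|: heavy)|).
  apply: subset_leq_card; apply/subsetP => X /imsetP[f]; rewrite in_set => /andP[_ s] ->.
  by rewrite powersetE.
rewrite card_powerset leq_exp2l // -(vs3 e).
exact: (leq_card_setU _ _).1.
Qed.

Lemma idle_ge : (0 < D)%N ->
  52 / 243 - ((2 ^ (3 + #|heavy|))%N%:R / (3 * D)%N%:R + (6 * k + 6)%N%:R / (9 * D)%N%:R)
    <= idle vs F (3 * D) R e.
Proof.
move=> D0.
have [a [b [c vse]]] : exists a b c, vs e = [set a; b; c].
  have := vs3 e; case: (set_0Vmem (vs e)) => [->|[a ae]]; first by rewrite cards0.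
  rewrite (cardsD1 a) ae add1n => /eqP; rewrite eqSS => /cards2P[b [c [_ h]]].
  by exists a, b, c; rewrite -(setD1K ae) h setUA.
have ae : a \in vs e by rewrite vse !inE eqxx.
have be : b \in vs e by rewrite vse !inE eqxx orbT.
have ce : c \in vs e by rewrite vse !inE eqxx !orbT.
have abc v : v \in vs e -> [|| v == a, v == b | v == c] by rewrite vse !inE orbA.
pose cl (x y z : bool) (g : bool) := [set f in F | [&& (a \in vs f) == x, (b \in vs f) == y,
  (c \in vs f) == z & g || (#|vs f :&: heavy| <= 1)%N]].
set A := cl true false false false; set B := cl false true false false.
set C := cl false false true false; set P := cl true true false true.
set Q := cl true false true true; set T := cl false true true true.
have clE x y z g f : f \in cl x y z g = [&& f \in F, (a \in vs f) == x, (b \in vs f) == y,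
  (c \in vs f) == z & g || (#|vs f :&: heavy| <= 1)%N] by rewrite in_set.
have nbrE f : (f \in nbr vs F e) = (f \in F) && [|| a \in vs f, b \in vs f | c \in vs f].
  rewrite in_set; congr (_ && _); apply/incP/idP => [[v /abc /or3P[] /eqP-> ->]|]; rewrite ?orbT //.
  by case/or3P => vf; [exists a | exists b | exists c].
have starE v f : (f \in star vs F v) = (f \in F) && (v \in vs f) by rewrite in_set.
have ha f : ((f \in A) + (f \in P) + (f \in Q) <= (f \in star vs F a))%N.
  rewrite !clE starE; case: (f \in F) => //=.
  by case: (a \in vs f); case: (b \in vs f); case: (c \in vs f) => //=; case: (#|_| <= 1)%N.
have hb f : ((f \in B) + (f \in P) + (f \in T) <= (f \in star vs F b))%N.
  rewrite !clE starE; case: (f \in F) => //=.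
  by case: (a \in vs f); case: (b \in vs f); case: (c \in vs f) => //=; case: (#|_| <= 1)%N.
have hc f : ((f \in C) + (f \in Q) + (f \in T) <= (f \in star vs F c))%N.
  rewrite !clE starE; case: (f \in F) => //=.
  by case: (a \in vs f); case: (b \in vs f); case: (c \in vs f) => //=; case: (#|_| <= 1)%N.
have hd f : ((f \in A) + (f \in B) + (f \in C) + (f \in P) + (f \in Q) + (f \in T) <= 1)%N.
  rewrite !clE; case: (f \in F) => //=.
  by case: (a \in vs f); case: (b \in vs f); case: (c \in vs f) => //=; case: (#|_| <= 1)%N.
have cov f : f \in nbr vs F e -> f \in A :|: B :|: C :|: P :|: Q :|: T :|: crowded.
  rewrite nbrE => /andP[fF abcf].
  have sub : (1 < #|vs f :&: heavy|)%N -> f \in crowded.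
    move=> h2; rewrite in_set fF /=; apply/subsetP => v vf; rewrite in_setU.
    case: (boolP (v \in vs e)) => //= ve.
    have h1 : (0 < #|vs f :&: vs e|)%N.
      apply/card_gt0P; case/or3P: abcf => xf; [exists a | exists b | exists c]; exact/setIP.
    apply: contraT => vh.
    have : (#|v |: (vs f :&: heavy :|: (vs f :&: vs e))| <= 3)%N.
      rewrite -(vs3 f) subset_leq_card // !subUset sub1set vf !subsetIl //.
    rewrite cardsU1 cardsU !in_setU !in_setI (negPf vh) (negPf ve) !andbF /=.
    have -> : vs f :&: heavy :&: (vs f :&: vs e) = set0.
      by apply/setP => x; rewrite !in_setI in_set0 in_set; case: (x \in vs e); rewrite ?andbF.
    by rewrite cards0 subn0; clear -h1 h2; lia.
  rewrite !in_setU !clE fF /=.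
  case: leqP sub => [_ _|_ /(_ isT) ->]; last by rewrite orbT.
  move: abcf; case: (boolP (a \in vs f)) => af; case: (boolP (b \in vs f)) => bf;
    case: (boolP (c \in vs f)) => cf //= _.
  rewrite in_set fF subsetU //.
  suff -> : vs f = vs e by rewrite subxx.
  apply/eqP; rewrite eq_sym eqEcard !vs3 leqnn andbT.
  by apply/subsetP => v /abc /or3P[] /eqP->.
have ZF : crowded \subset F by apply/subsetP => f; rewrite in_set => /andP[].
have n0 : (0 < 3 * D)%N by rewrite muln_gt0.
have low := @idle_lower V E vs F (3 * D) D R vs_neq0 n0 (fun f _ => card_nbr f) starD (leqnn _)
  e a b c A B C P Q T crowded ha hb hc hd ZF cov.
apply: le_trans low.
have clN x y z g f : [|| x, y | z] -> f \in cl x y z g -> f \in nbr vs F e.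
  rewrite clE nbrE => xyz /and5P[-> /eqP-> /eqP-> /eqP-> _]; exact: xyz.
have clI x y z g f : [|| x, y | z] -> f \in cl x y z g -> inc vs f e.
  by move=> xyz /(clN _ _ _ _ _ xyz); rewrite in_set incC => /andP[].
have sep x y z g x' y' z' g' f h v : ~~ [|| x && x', y && y' | z && z'] ->
    f \in cl x y z g -> h \in cl x' y' z' g' -> v \in vs f -> v \in vs h -> v \notin vs e.
  rewrite !clE => nx /and5P[_ /eqP fa /eqP fb /eqP fc _] /and5P[_ /eqP ka /eqP kb /eqP kc _] vf vh.
  apply: contra nx => /abc /or3P[] /eqP ev; move: vf vh; rewrite ev ?fa ?fb ?fc ?ka ?kb ?kc => -> ->;
  by rewrite ?orbT.
have AB : #|A|%:R * #|B|%:R - \sum_(x in heavy) mult A x * mult B x - k%:R * (2 * #|A|%:R)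
    <= apart2 vs R A B.
  by apply: mult_outer => [h|h|g h v]; [apply: clI | apply: clN | apply: sep].
have AC : #|A|%:R * #|C|%:R - \sum_(x in heavy) mult A x * mult C x - k%:R * (2 * #|A|%:R)
    <= apart2 vs R A C.
  by apply: mult_outer => [h|h|g h v]; [apply: clI | apply: clN | apply: sep].
have BC : #|B|%:R * #|C|%:R - \sum_(x in heavy) mult B x * mult C x - k%:R * (2 * #|B|%:R)
    <= apart2 vs R B C.
  by apply: mult_outer => [h|h|g h v]; [apply: clI | apply: clN | apply: sep].
have le1 x y z (X Y : {set E}) : X = cl x y z true -> (1 < x + y + z)%N ->
    (forall f h v, f \in X -> h \in Y -> v \in vs f -> v \in vs h -> v \notin vs e) ->
    (forall f, f \in Y -> inc vs f e) -> (#|Y| <= D)%N ->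
   #|X|%:R * #|Y|%:R - 2 * D%:R <= apart2 vs R X Y.
  move=> Xe xyz s iY YD; apply: le_trans (apart2_lower s); rewrite lerD2l lerN2.
  apply: (@le_trans _ _ (\sum_(v in ~: vs e) mult Y v)).
    apply: ler_sum => v; rewrite in_setC => ve; rewrite ler_piMl // lern1.
    apply/card_le1_eqP => f h; rewrite !in_set Xe !clE.
    move=> /andP[/and5P[_ /eqP fa /eqP fb /eqP fc _] vf].
    move=> /andP[/and5P[_ /eqP ka /eqP kb /eqP kc _] vh]; apply: vsI.
    have core g : v \in vs g -> (a \in vs g) = x -> (b \in vs g) = y -> (c \in vs g) = z ->
        v |: (vs e :&: vs f) = vs g.
      move=> vg ga gb gc; apply/eqP; rewrite eqEcard subUset sub1set vg /=; apply/andP; split.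
        apply/subsetP => w /setIP[/abc /or3P[] /eqP->]; first by rewrite fa ga.
          by rewrite fb gb.
        by rewrite fc gc.
      have : (#|vs e :\: vs f| <= 1)%N.
        apply/card_le1_eqP => w w' /setDP[/abc ew wf] /setDP[/abc ew' wf'].
        move: wf wf' xyz; case/or3P: ew => /eqP->; case/or3P: ew' => /eqP-> //;
        rewrite ?fa ?fb ?fc; by clear; case: x; case: y; case: z.
      have := cardsID (vs f) (vs e); rewrite cardsU1 in_setI (negPf ve) /= !vs3.
      by clear; lia.
    by rewrite -(core f) // (core h).
  apply: le_trans (sum_mult (m := 2) _) _.
    by move=> f /iY; apply: card_outer.
  by rewrite ler_wpM2l // ler_nat.
have starS (X : {set E}) v : (forall f, f \in X -> f \in star vs F v) -> (#|X| <= D)%N.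
  by move=> H; apply: leq_trans (starD v); apply/subset_leq_card/subsetP.
have AD : (#|A| <= D)%N by apply: (starS _ a) => f fA; move: (ha f); rewrite fA; case: (f \in star _ _ _).
have BD : (#|B| <= D)%N by apply: (starS _ b) => f fA; move: (hb f); rewrite fA; case: (f \in star _ _ _).
have CD : (#|C| <= D)%N by apply: (starS _ c) => f fA; move: (hc f); rewrite fA; case: (f \in star _ _ _).
have PC : #|P|%:R * #|C|%:R - 2 * D%:R <= apart2 vs R P C.
  by apply: (le1 true true false) => // [f h v|f]; [apply: sep | apply: clI].
have QB : #|Q|%:R * #|B|%:R - 2 * D%:R <= apart2 vs R Q B.
  by apply: (le1 true false true) => // [f h v|f]; [apply: sep | apply: clI].
have TA : #|T|%:R * #|A|%:R - 2 * D%:R <= apart2 vs R T A.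
  by apply: (le1 false true true) => // [f h v|f]; [apply: sep | apply: clI].
have ABC : apart3 vs R A B C <= #|A|%:R * #|B|%:R * #|C|%:R
    - #|C|%:R * (\sum_(x in heavy) mult A x * mult B x)
    - #|B|%:R * (\sum_(x in heavy) mult A x * mult C x)
    - #|A|%:R * (\sum_(x in heavy) mult B x * mult C x)
    + 2 * (\sum_(x in heavy) mult A x * mult B x * mult C x).
  apply: apart3_upper => f; rewrite !in_setU !clE => /orP[/orP[]|] /and5P[_ _ _ _]; exact.
have mD x : mult A x + mult B x + mult C x <= D%:R.
  rewrite /mult -!natrD ler_nat; apply: leq_trans (starD x); apply: card_sum3 => f.
  rewrite starE !in_set; case: (f \in F) => //=; case: (x \in vs f); rewrite ?andbF // !andbT.
  by case: (a \in vs f); case: (b \in vs f); case: (c \in vs f) => //=; case: (#|_| <= 1)%N.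
have m0 (X : {set E}) x : 0 <= mult X x by apply: ler0n.
have sm (X : {set E}) : (forall f, f \in X -> (#|vs f :&: heavy| <= 1)%N) ->
    \sum_(x in heavy) mult X x <= #|X|%:R.
  by move=> H; rewrite -[leRHS]mul1r; apply: (sum_mult (m := 1)).
have smA : \sum_(x in heavy) mult A x <= #|A|%:R by apply: sm => f; rewrite clE => /and5P[].
have smB : \sum_(x in heavy) mult B x <= #|B|%:R by apply: sm => f; rewrite clE => /and5P[].
have smC : \sum_(x in heavy) mult C x <= #|C|%:R by apply: sm => f; rewrite clE => /and5P[].
have dR : 0 < D%:R :> R by rewrite ltr0n.
have e9 : (9 * D)%N%:R = 9 * D%:R :> R by rewrite natrM.
have e3 : (3 * D)%N%:R = 3 * D%:R :> R by rewrite natrM.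
have e6 : (6 * k + 6)%N%:R = 6 * k%:R + 6 :> R by rewrite natrD natrM.
rewrite e9 e3 e6.
apply: (pair_triple_scaled (S12 := \sum_(x in heavy) mult A x * mult B x)
  (S13 := \sum_(x in heavy) mult A x * mult C x)
  (S23 := \sum_(x in heavy) mult B x * mult C x)
  (T := \sum_(x in heavy) mult A x * mult B x * mult C x)) => //; rewrite ?ler0n //.
- by rewrite -!natrD ler_nat (leq_trans _ (starD a)) // card_sum3.
- by rewrite -!natrD ler_nat (leq_trans _ (starD b)) // card_sum3.
- by rewrite -!natrD ler_nat (leq_trans _ (starD c)) // card_sum3.
- by rewrite sumr_ge0 // => x _; rewrite mulr_ge0.
- by rewrite sumr_ge0 // => x _; rewrite mulr_ge0.
- by rewrite sumr_ge0 // => x _; rewrite mulr_ge0.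
- apply: (@le_trans _ _ (D%:R * (\sum_(x in heavy) (mult A x + mult B x + mult C x)) / 3)).
    rewrite -!big_split /= mulr_sumr mulr_suml; apply: ler_sum => x _.
    have := mD x; have := m0 A x; have := m0 B x; have := m0 C x; clear.
    move: (mult A x) (mult B x) (mult C x) => u v w w0 v0 u0 h.
    have : (u + v + w) * (u + v + w) <= D%:R * (u + v + w) by rewrite ler_wpM2r //; lra.
    have := sqr_ge0 (u - v); have := sqr_ge0 (u - w); have := sqr_ge0 (v - w); nra.
  rewrite ler_wpM2r ?invr_ge0 // ler_wpM2l // !big_split /=; clear -smA smB smC; lra.
- rewrite -!big_split /= mulr_sumr mulr_suml; apply: ler_sum => x _.
  have := mD x; have := m0 A x; have := m0 B x; have := m0 C x; clear.
  move: (mult A x) (mult B x) (mult C x) => u v w w0 v0 u0 h.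
  have uv := mulr_ge0 u0 v0; have uw := mulr_ge0 u0 w0; have vw := mulr_ge0 v0 w0.
  have : (u * v + u * w + v * w) * (u + v + w) <= (u * v + u * w + v * w) * D%:R.
    by rewrite ler_wpM2l //; lra.
  have := mulr_ge0 u0 (sqr_ge0 (v - w)); have := mulr_ge0 v0 (sqr_ge0 (u - w)).
  have := mulr_ge0 w0 (sqr_ge0 (u - v)); nra.
- by rewrite ler_nat card_crowded.
Qed.

End Estimate.

(** * Composite rounds *)

Lemma mean_pair (R : realFieldType) (O1 O2 : finType) (f : O1 -> R) (g : O2 -> R) :
  mean (fun w : O1 * O2 => f w.1 * g w.2) = mean f * mean g.
Proof.
rewrite /mean card_prod natrM invfM mulrACA; congr (_ * _).
rewrite big_distrlr /= pair_big /=; exact: eq_bigr.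
Qed.

Lemma mean_fst (R : realFieldType) (O1 O2 : finType) (f : O1 -> R) :
  (0 < #|O2|)%N -> mean (fun w : O1 * O2 => f w.1) = mean f.
Proof.
move=> O0; rewrite -[RHS]mulr1 -(mean_cst 1 O0) -mean_pair.
by apply: eq_mean => w; rewrite mulr1.
Qed.

Lemma mean_fubini (R : realFieldType) (O1 O2 : finType) (f : O1 -> O2 -> R) :
  mean (fun w : O1 * O2 => f w.1 w.2) = mean (fun x => mean (f x)).
Proof.
transitivity ((\sum_x \sum_y f x y) / #|O2|%:R / #|O1|%:R).
  by rewrite /mean pair_big card_prod natrM invfM mulrA mulrAC.
by rewrite /mean [in LHS]mulr_suml.
Qed.

Section Composite.
Variables (V E : finType) (vs : E -> {set V}) (F : {set E}) (n : nat) (R : realFieldType).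
Hypothesis ne : forall e, vs e != set0.
Hypothesis n0 : (0 < n)%N.
Hypothesis nbrn : forall e, e \in F -> (#|nbr vs F e| <= n)%N.

Local Notation luby := (@luby V E vs F n).
Local Notation idle := (@idle V E vs F n R).

Fixpoint rounds (r : nat) : finType :=
  if r is r'.+1 then ({perm E * 'I_n.+1} * rounds r')%type : finType else unit.

(* An edge that loses a round survives it only if none of its neighbours won,
   regardless of whether that winner had been discarded before: this wastes
   some edges but makes the rounds independent. *)
Fixpoint composite (r : nat) : rounds r -> {set E} :=
  if r is r'.+1 then
    fun w => luby w.1 :|: [set e in composite w.2 | luby w.1 :&: nbr vs F e == set0]
  else fun=> set0.

Fixpoint agree_rounds (r : nat) : {set E} -> rounds r -> rounds r -> Prop :=
  if r is r'.+1 then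
    fun B w w' => (forall x y, x.1 \in B -> y.1 \in B -> before w.1 x y = before w'.1 x y) /\
      agree_rounds B w.2 w'.2
  else fun _ _ _ => True.

Lemma card_rounds r : (0 < #|rounds r|)%N.
Proof.
elim: r => [|r IH] /=; first by rewrite card_unit.
by rewrite card_prod muln_gt0 IH andbT; apply/card_gt0P; exists 1%g.
Qed.

Lemma resamplable_rounds r : resamplable (@agree_rounds r).
Proof.
elim: r => [|r IH] /=; first exact: resamplable_unit.
exact: (resamplable_prod (@resamplable_perm E 'I_n.+1) IH).
Qed.

Lemma mem_compositeS r (w : rounds r.+1) e : (e \in composite w) =
  (e \in luby w.1) || (e \in composite w.2) && (luby w.1 :&: nbr vs F e == set0).
Proof. by rewrite in_setU [X in _ || X]in_set. Qed.

Lemma composite_matching r (w : rounds r) e f :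
  e \in composite w -> f \in composite w -> inc vs e f -> e = f.
Proof.
elim: r w => [|r IH] w; first by rewrite inE.
have dis x y : x \in luby w.1 -> luby w.1 :&: nbr vs F y == set0 -> ~~ inc vs y x.
  move=> xl /eqP/setP/(_ x); rewrite !in_setI xl in_set0 /= in_set.
  by rewrite (subsetP (luby_sub _ _ _) _ xl) /= => ->.
rewrite !mem_compositeS => /orP[el|/andP[ec ez]] /orP[fl|/andP[fc fz]] ef.
- exact: luby_indep el fl ef.
- by move: (dis _ _ el fz); rewrite incC ef.
- by move: (dis _ _ fl ez); rewrite ef.
- exact: IH ec fc ef.
Qed.

Lemma mean_composite r e : e \in F ->
  mean (fun w : rounds r.+1 => (e \in composite w)%:R) =
  n%:R^-1 + idle e * mean (fun w : rounds r => (e \in composite w)%:R).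
Proof.
move=> eF; rewrite /idle -mean_pair -(win1E ne nbrn R eF) /win1.
rewrite -[X in _ = X + _](mean_fst (O2 := rounds r)) ?card_rounds // -meanD.
apply: eq_mean => -[s t]; rewrite mem_compositeS /= /win.
case: (boolP (e \in luby s)) => el /=; last by rewrite add0r -natrM mulnb andbC.
case: eqP => [/setP/(_ e)|_]; last by rewrite mul0r addr0.
by rewrite in_setI el in_set0 in_set eF inc_refl.
Qed.

Lemma mean_composite_ge r e (l : R) : e \in F -> 0 <= l -> l < 1 -> l <= idle e ->
  (1 - l ^+ r) / (1 - l) / n%:R <= mean (fun w : rounds r => (e \in composite w)%:R).
Proof.
move=> eF l0 l1 li; have nR : 0 < n%:R :> R by rewrite ltr0n.
elim: r => [|r IH].
  by rewrite expr0 subrr !mul0r divr_ge0 // sumr_ge0.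
rewrite mean_composite //.
apply: (@le_trans _ _ (n%:R^-1 + l * ((1 - l ^+ r) / (1 - l) / n%:R))).
  rewrite -subr_ge0 exprS; set X := (X in 0 <= X); suff -> : X = 0 by [].
  by rewrite /X; field; rewrite gt_eqF //= subr_eq0 gt_eqF.
rewrite lerD2l; apply: ler_pM => //.
have l1' := ltW l1; by rewrite divr_ge0 ?ler0n // divr_ge0 // subr_ge0 // exprn_ile1.
Qed.

Definition ball2 e : {set E} := \bigcup_(f in nbr vs F e) nbr vs F f.

Lemma nbr_ball2 e : e \in F -> nbr vs F e \subset ball2 e.
Proof.
by move=> eF; apply: (bigcup_max e) => //; rewrite in_set eF inc_refl.
Qed.

Lemma luby_local (w w' : {perm E * 'I_n.+1}) (B : {set E}) e :
    (forall x y, x.1 \in B -> y.1 \in B -> before w x y = before w' x y) ->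
    nbr vs F e \subset B -> (e \in luby w) = (e \in luby w').
Proof.
move=> ag /subsetP sB; rewrite !mem_luby; case: (boolP (e \in F)) => //= eF.
have eB : e \in B by apply: sB; rewrite in_set eF inc_refl.
have tB x : x \in tickets vs F n e -> x.1 \in B.
  by rewrite in_set => /orP[/andP[_ /sB]|/andP[/eqP-> _]].
by apply/firstP/firstP => -[H0 H]; split=> // y yt; have := H y yt; rewrite ag // tB.
Qed.

Lemma composite_local r (w w' : rounds r) (B : {set E}) e :
    agree_rounds B w w' -> e \in F -> ball2 e \subset B ->
  (e \in composite w) = (e \in composite w').
Proof.
elim: r w w' => [|r IH] w w'; first by rewrite !inE.
move=> [ag1 ag2] eF sB.
have idl : (luby w.1 :&: nbr vs F e == set0) = (luby w'.1 :&: nbr vs F e == set0).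
  congr (_ == _); apply/setP => f; rewrite !in_setI.
  case: (boolP (f \in nbr vs F e)) => fN; last by rewrite !andbF.
  rewrite !andbT; apply: luby_local ag1 _; apply: subset_trans sB.
  exact: (bigcup_max f).
rewrite !mem_compositeS idl (IH _ _ ag2 eF sB); congr (_ || _).
by apply: luby_local ag1 _; apply: subset_trans sB; apply: nbr_ball2.
Qed.

End Composite.

(** * A batch of colours *)

Section Colorable.
Variables (V E : finType) (vs : E -> {set V}).

Definition colorable (F : {set E}) (n : nat) : Prop :=
  exists c : E -> nat, (forall e, e \in F -> (c e < n)%N) /\
    (forall e f, e \in F -> f \in F -> e != f -> inc vs e f -> c e != c f).

Lemma colorable_matching (F M : {set E}) n :
    (forall e f, e \in M -> f \in M -> inc vs e f -> e = f) ->
  colorable (F :\: M) n -> colorable F n.+1.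
Proof.
move=> HM [c [cn cp]]; exists (fun e => if e \in M then n else c e); split.
  move=> e eF; case: (boolP (e \in M)) => // eM.
  by apply: leqW; apply: cn; rewrite inE eM.
move=> e f eF fF ef i.
case: (boolP (e \in M)) => eM; case: (boolP (f \in M)) => fM.
- by rewrite (HM e f) // eqxx in ef.
- by rewrite gtn_eqF // cn // inE fM.
- by rewrite ltn_eqF // cn // inE eM.
- by apply: cp; rewrite ?inE ?eM ?fM.
Qed.

Lemma colorable_greedy (F : {set E}) (d : nat) : (forall e, vs e != set0) ->
    (forall e, e \in F -> (#|nbr vs F e| <= d)%N) -> colorable F d.
Proof.
move=> ne; elim: {F}#|F| {-2}F (erefl #|F|) => [|m IH] F cF H.
  exists (fun=> 0%N); split=> [e|e f]; by rewrite (cards0_eq cF) inE.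
have /card_gt0P[e eF] : (0 < #|F|)%N by rewrite cF.
have [|f fF|c [cd cp]] := IH (F :\ e).
- by move: cF; rewrite (cardsD1 e) eF => -[].
- apply: leq_trans (H f _); last by move: fF; rewrite inE => /andP[].
  apply: subset_leq_card; apply/subsetP => g; rewrite !in_set.
  by case/andP => /andP[_ ->] ->.
have [col colN] : exists col : 'I_d, forall f, f \in nbr vs F e :\ e -> c f != col.
  have [all|] := boolP [forall col : 'I_d, exists f in nbr vs F e :\ e, c f == col]; last first.
    rewrite negb_forall => /existsP[col no]; exists col => // f fN.
    by apply: contra no => cf; apply/existsP; exists f; rewrite fN.
  have eN : e \in nbr vs F e by rewrite in_set eF (inc_refl ne).
  have := H e eF; rewrite (cardsD1 e) eN add1n ltnNge => /negP nd; exfalso; apply: nd.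
  pose g (col : 'I_d) := odflt e [pick f in nbr vs F e :\ e | c f == col].
  have gP col : (g col \in nbr vs F e :\ e) && (c (g col) == col).
    rewrite /g; case: pickP => //= no; move/forallP/(_ col)/existsP: all => [f].
    by rewrite no.
  rewrite -[X in (X <= _)%N]card_ord -(card_codom (f := g)); last first.
    by move=> i j ij; apply: ord_inj; have /andP[_ /eqP <-] := gP i; have /andP[_ /eqP <-] := gP j; rewrite ij.
  by apply: subset_leq_card; apply/subsetP => f /codomP[i ->]; case/andP: (gP i).
exists (fun f => if f == e then col : nat else c f); split.
  by move=> f fF; case: eqP => // /eqP fe; apply: cd; rewrite !inE fe.
move=> f g fF gF fg i /=; case: (f =P e) => [fe|/eqP fe]; case: (g =P e) => [ge|/eqP ge].
- by rewrite fe ge eqxx in fg.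
- by rewrite eq_sym; apply: colN; rewrite in_setD1 ge in_set gF -fe.
- by apply: colN; rewrite in_setD1 fe in_set fF -ge incC.
- by apply: cp; rewrite ?in_setD1 ?fe ?ge.
Qed.

End Colorable.

Section ManyColors.
Variables (V E : finType) (vs : E -> {set V}) (F : {set E}) (D : nat) (R : realFieldType).
Hypothesis vs3 : forall e, #|vs e| = 3%N.
Hypothesis starD : forall v, (#|star vs F v| <= D)%N.

Variables (T : finType) (M : T -> {set E}) (agree : {set E} -> T -> T -> Prop).
Variable rho : R.
Hypothesis rho0 : 0 <= rho.
Hypothesis T0 : (0 < #|T|)%N.
Hypothesis matchM : forall t e f, e \in M t -> f \in M t -> inc vs e f -> e = f.
Hypothesis resM : resamplable agree.
Hypothesis localM : forall t t' (B : {set E}) e,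
  agree B t t' -> e \in F -> ball2 vs F e \subset B -> (e \in M t) = (e \in M t').
Hypothesis meanM : forall e, e \in F -> rho <= mean (fun t => (e \in M t)%:R).

Fixpoint draws (m : nat) : finType :=
  if m is m'.+1 then (T * draws m')%type : finType else unit.

Fixpoint left_over (m : nat) : {set E} -> draws m -> {set E} :=
  if m is m'.+1 then fun S w => left_over (S :\: M w.1) w.2 else fun S _ => S.

Fixpoint agree_draws (m : nat) : {set E} -> draws m -> draws m -> Prop :=
  if m is m'.+1 then fun B w w' => agree B w.1 w'.1 /\ agree_draws B w.2 w'.2
  else fun _ _ _ => True.

Lemma card_draws m : (0 < #|draws m|)%N.
Proof.
elim: m => [|m IH] /=; first by rewrite card_unit.
by rewrite card_prod muln_gt0 T0.
Qed.

Lemma resamplable_draws m : resamplable (@agree_draws m).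
Proof.
elim: m => [|m IH] /=; first exact: resamplable_unit.
exact: resamplable_prod resM IH.
Qed.

Lemma left_over_sub m (S : {set E}) (w : draws m) : left_over S w \subset S.
Proof.
elim: m S w => [|m IH] S w /=; first exact: subxx.
exact: subset_trans (IH _ _) (subsetDl _ _).
Qed.

Lemma left_over_star m (S : {set E}) (w : draws m) v :
  star vs (left_over S w) v = left_over (star vs S v) w.
Proof.
elim: m S w => [|m IH] S w //=; rewrite IH; congr left_over.
by apply/setP => f; rewrite !inE andbA.
Qed.

Lemma colorable_left_over m (S : {set E}) (w : draws m) n :
  colorable vs (left_over S w) n -> colorable vs S (n + m).
Proof.
elim: m S w => [|m IH] S w /=; first by rewrite addn0.
move=> /IH; rewrite addnS; exact: (colorable_matching (@matchM w.1)).
Qed.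

Lemma left_over_local m (S : {set E}) (w w' : draws m) (B : {set E}) :
    agree_draws B w w' -> S \subset F -> (forall e, e \in S -> ball2 vs F e \subset B) ->
  left_over S w = left_over S w'.
Proof.
elim: m S w w' => [|m IH] S w w' //= [ag1 ag2] SF SB.
have -> : S :\: M w'.1 = S :\: M w.1.
  apply/setP => e; rewrite !in_setD; case: (boolP (e \in S)) => eS; last by rewrite !andbF.
  by rewrite (localM ag1 (subsetP SF _ eS) (SB _ eS)).
apply: IH ag2 _ _; first exact: subset_trans (subsetDl _ _) SF.
by move=> e; rewrite inE => /andP[_ /SB].
Qed.

Lemma left_over_tail (m D' : nat) (v : V) (p x : R) (S : {set E}) :
    0 < x -> x <= 1 -> 0 <= p -> p <= 1 -> p <= D'%:R * rho -> S \subset star vs F v ->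
  mean (fun w : draws m => (D' < #|left_over S w|)%N%:R) <=
    (1 - p * (1 - x)) ^+ m * x^-1 ^+ (#|S| - D').
Proof.
move=> x0 x1 p0 p1 pD; have ix1 : 1 <= x^-1 by rewrite invf_ge1.
have ix0 : 0 < x^-1 by rewrite invr_gt0.
have q0 : 0 <= 1 - p * (1 - x).
  by rewrite subr_ge0 mulr_ile1 ?subr_ge0 // gerBl ltW.
elim: m S => [|m IH] S Sv.
  rewrite expr0 mul1r (@le_trans _ _ 1) // ?exprn_ege1 //.
  rewrite -[leRHS](mean_cst 1 (card_draws 0)); apply: le_mean => w.
  by rewrite lern1 leq_b1.
have [SD|SD] := leqP #|S| D'.
  rewrite (eq_mean (Y := fun=> 0)).
    by rewrite mean_cst ?card_draws // mulr_ge0 // exprn_ge0 // ltW.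
  move=> w; rewrite ltnNge; suff -> : (#|left_over S w| <= D')%N by [].
  exact: leq_trans (subset_leq_card (left_over_sub _ _)) SD.
have hit1 t : (#|S :&: M t| <= 1)%N.
  apply/card_le1_eqP => e f; rewrite !inE => /andP[eS eM] /andP[fS fM].
  apply/esym; apply: (matchM eM fM); apply/incP; exists v.
    by have := subsetP Sv _ eS; rewrite inE => /andP[].
  by have := subsetP Sv _ fS; rewrite inE => /andP[].
have hitp : p <= mean (fun t => #|S :&: M t|%:R).
  apply: (le_trans pD).
  rewrite (eq_mean (Y := fun t => \sum_(e in S) (e \in M t)%:R)); last first.
    move=> t; rewrite -sum1_card natr_sum big_mkcond [RHS]big_mkcond /=; apply: eq_bigr => e _.
    by rewrite inE; case: (e \in S); case: (e \in M t).
  rewrite mean_sum; apply: (@le_trans _ _ (\sum_(e in S) rho)).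
    rewrite sumr_const -[rho *+ _]mulr_natl.
    by rewrite ler_wpM2r // ler_nat ltnW.
  apply: ler_sum => e eS; apply: meanM.
  by have := subsetP Sv _ eS; rewrite inE => /andP[].
rewrite (mean_fubini (fun t (w : draws m) => (D' < #|left_over (S :\: M t) w|)%N%:R)).
set k := (#|S| - D')%N; set Q := 1 - p * (1 - x).
apply: (@le_trans _ _ (mean (fun t : T => Q ^+ m * x^-1 ^+ k * (1 - #|S :&: M t|%:R * (1 - x))))).
  apply: le_mean => t; apply: (le_trans (IH _ _)).
    exact: subset_trans (subsetDl _ _) Sv.
  rewrite -mulrA ler_wpM2l ?exprn_ge0 //; rewrite -/k.
  have := hit1 t; have := cardsID (M t) S; rewrite /k.
  case: #|S :&: M t| => [|[|//]] cS _.
    by rewrite mul0r subr0 mulr1 -cS add0n.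
  rewrite mul1r opprB addrC subrK.
  have -> : (#|S| - D')%N = (#|S :\: M t| - D').+1 by move: cS SD; clear; lia.
  by rewrite exprS mulrAC mulVf ?mul1r // gt_eqF.
rewrite (eq_mean (Y := fun t => Q ^+ m * x^-1 ^+ k - Q ^+ m * x^-1 ^+ k * (1 - x) * #|S :&: M t|%:R)).
  rewrite meanD mean_cst // meanN exprS.
  have -> : mean (fun t => Q ^+ m * x^-1 ^+ k * (1 - x) * #|S :&: M t|%:R) =
     Q ^+ m * x^-1 ^+ k * (1 - x) * mean (fun t => #|S :&: M t|%:R).
    by rewrite /mean -mulr_sumr mulrA.
  have c0 : 0 <= Q ^+ m * x^-1 ^+ k by rewrite mulr_ge0 // exprn_ge0 // ltW.
  have c1 : 0 <= Q ^+ m * x^-1 ^+ k * (1 - x) by rewrite mulr_ge0 // subr_ge0.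
  have := ler_wpM2l c1 hitp; move: (Q ^+ m) (x^-1 ^+ k) (mean _) => Y Z W h.
  have -> : Q * Y * Z = Y * Z - Y * Z * (1 - x) * p by rewrite /Q; ring.
  by rewrite lerD2l lerN2.
by move=> t; ring.
Qed.

Lemma ball2_sym e f : f \in F -> e \in ball2 vs F f -> f \in ball2 vs F e.
Proof.
move=> fF /bigcupP[g]; rewrite in_set => /andP[gF fg]; rewrite in_set => /andP[eF ge].
by apply/bigcupP; exists g; rewrite in_set ?gF ?fF incC.
Qed.

Definition reach v : {set E} := \bigcup_(e in star vs F v) ball2 vs F e.

Lemma card_touching v : (#|[set u | ~~ [disjoint reach v & reach u]]| <= 243 * D ^ 5)%N.
Proof.
have nbr3 := card_nbr vs3 starD.
have b2 e : (#|ball2 vs F e| <= 3 * D * (3 * D))%N by apply: card_bigcup_le.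
have s : [set u | ~~ [disjoint reach v & reach u]] \subset
    \bigcup_(g in reach v) \bigcup_(e in ball2 vs F g) vs e.
  apply/subsetP => u; rewrite inE -setI_eq0 => /set0Pn[g /setIP[gv /bigcupP[e eu ge]]].
  apply/bigcupP; exists g => //; apply/bigcupP; exists e.
    by apply: ball2_sym ge; move: eu; rewrite inE => /andP[].
  by move: eu; rewrite inE => /andP[].
apply: (leq_trans (subset_leq_card s)).
apply: (@leq_trans (D * (3 * D * (3 * D)) * (3 * D * (3 * D) * 3))).
  apply: card_bigcup_le; first by apply: card_bigcup_le.
  by move=> g _; apply: card_bigcup_le => // e _; rewrite vs3.
by rewrite !expnS expn0 muln1; clear; lia.
Qed.

Lemma exists_good_draws (m D' : nat) (p x : R) :
    (0 < D)%N -> 0 < x -> x <= 1 -> 0 <= p -> p <= 1 -> p <= D'%:R * rho ->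
    (4 * (243 * D ^ 5))%N%:R * ((1 - p * (1 - x)) ^+ m * x^-1 ^+ (D - D')) <= 1 ->
  exists w : draws m, forall v, (#|star vs (left_over F w) v| <= D')%N.
Proof.
move=> D0 x0 x1 p0 p1 pD small.
pose bad v : {set draws m} := [set w | (D' < #|left_over (star vs F v) w|)%N].
have detB v (B : {set E}) : reach v \subset B -> determined (@agree_draws m) B (bad v).
  move=> vB w w' ag; rewrite !in_set.
  have -> // := @left_over_local m (star vs F v) w w' B ag.
    by apply/subsetP => e; rewrite inE => /andP[].
  by move=> e ev; apply: subset_trans vB; apply: (bigcup_max e).
pose nb v := [set u | ~~ [disjoint reach v & reach u]].
have [w wP] : exists w, forall v, w \notin bad v.
  apply: (@lovasz_local _ _ bad nb (243 * D ^ 5)).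
  - by rewrite muln_gt0 expn_gt0 D0.
  - exact: card_draws.
  - exact: card_touching.
  - move=> v S dis _.
    apply: (resamplable_indep (@resamplable_draws m) (B := reach v)
      (C := \bigcup_(u in S) reach u)).
    + apply/bigcup_disjointP => u uS.
      by have := disjointFr dis uS; rewrite inE => /negbFE.
    + by apply: detB.
    + move=> w w' ag; apply/avoidP/avoidP => H u uS; have := H u uS;
        by rewrite (detB u _ (bigcup_sup u uS) w w' ag).
  - move=> v; rewrite -(ler_nat R) natrM.
    have := left_over_tail m x0 x1 p0 p1 pD (subxx (star vs F v)).
    rewrite (eq_mean (Y := fun w => (w \in bad v)%:R)) => [|w]; last by rewrite inE.
    have dR : 0 < #|draws m|%:R :> R by rewrite ltr0n card_draws.
    rewrite mean_prob /prob => tail.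
    have {}tail : #|bad v|%:R / #|draws m|%:R <= (1 - p * (1 - x)) ^+ m * x^-1 ^+ (D - D').
      apply: (le_trans tail); rewrite ler_wpM2l //.
        by rewrite exprn_ge0 // subr_ge0 mulr_ile1 ?subr_ge0 // gerBl ltW.
      by rewrite ler_weXn2l ?invf_ge1 // leq_sub2r // starD.
    have := le_trans (ler_wpM2l (ler0n _ _) tail) small.
    by rewrite mulrA ler_pdivrMr // mul1r.
by exists w => v; rewrite left_over_star; have := wP v; rewrite inE -leqNgt.
Qed.

End ManyColors.

(** * Asymptotics *)

Section Asymptotics.
Variable R : realType.

Lemma exists_nat_ge (x : R) : exists n : nat, x <= n%:R.
Proof. by exists (Num.truncn x).+1; rewrite ltW // truncnS_gt. Qed.

Lemma floor_nat (x : R) : 0 <= x -> exists2 n : nat, n%:R <= x & x < n%:R + 1.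
Proof.
move=> x0; exists (Num.truncn x); first by rewrite truncn_le.
by rewrite natr1 truncnS_gt.
Qed.

Lemma idle_large (eps : R) : 0 < eps -> exists D1 : nat, forall D, (D1 <= D)%N ->
  forall (V E : finType) (vs : E -> {set V}) (F : {set E}),
    (forall e, #|vs e| = 3%N) -> injective vs -> (forall v, (#|star vs F v| <= D)%N) ->
  forall e, e \in F -> 52 / 243 - eps <= idle vs F (3 * D) R e.
Proof.
move=> eps0.
have [j0 hj0] := exists_nat_ge (2 / eps); pose j := j0.+1.
pose c : R := (2 ^ (3 + 6 * j))%N%:R + 4.
have [D1 hD1] := exists_nat_ge (4 * c / eps).
exists D1.+1 => D DD V E vs F vs3 vsI starD e eF.
have D0 : (0 < D)%N by apply: leq_trans DD.
have dR : 0 < D%:R :> R by rewrite ltr0n.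
have jR : 0 < j%:R :> R by rewrite ltr0n.
pose k := (D %/ j).+1.
apply: le_trans (@idle_ge _ _ vs F D k R vs3 vsI starD e eF D0).
have Hh : (#|heavy vs F k e| <= 6 * j)%N.
  rewrite -(leq_pmul2r D0) -mulnA [(j * D)%N]mulnC mulnA.
  apply: (@leq_trans (#|heavy vs F k e| * (k * j))).
    by rewrite leq_mul2l /k ltnW ?orbT // ltn_ceil.
  by rewrite mulnA leq_mul2r (card_heavy k R vs3 starD eF) orbT.
rewrite lerD2l lerN2.
apply: (@le_trans _ _ (c / D%:R + 2 / 3 / j%:R)).
  have h1 : ((2 ^ (3 + #|heavy vs F k e|))%N%:R : R) <= (2 ^ (3 + 6 * j))%N%:R.
    by rewrite ler_nat leq_exp2l // leq_add2l.
  have h2 : (k%:R : R) <= D%:R / j%:R + 1.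
    by rewrite /k -natr1 lerD2r ler_pdivlMr // -natrM ler_nat leq_divM.
  have id : 0 <= D%:R^-1 :> R by rewrite invr_ge0 ltW.
  have e9 : (9 * D)%N%:R = 9 * D%:R :> R by rewrite natrM.
  have e3 : (3 * D)%N%:R = 3 * D%:R :> R by rewrite natrM.
  have e6 : (6 * k + 6)%N%:R = 6 * k%:R + 6 :> R by rewrite natrD natrM.
  rewrite e9 e3 e6 /c.
  have -> : 2 / 3 / j%:R = 6 * (D%:R / j%:R) / (9 * D%:R) :> R.
    by field; rewrite !gt_eqF.
  move: h1; set x : R := (2 ^ (3 + #|_|))%N%:R; set y : R := (2 ^ (3 + 6 * j))%N%:R => h1.
  have -> : x / (3 * D%:R) + (6 * k%:R + 6) / (9 * D%:R) =
     (3 * x + 6 * k%:R + 6) / 9 * D%:R^-1 by field; rewrite gt_eqF.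
  have -> : (y + 4) / D%:R + 6 * (D%:R / j%:R) / (9 * D%:R) =
     (9 * (y + 4) + 6 * (D%:R / j%:R)) / 9 * D%:R^-1 by field; rewrite !gt_eqF.
  rewrite ler_wpM2r // ler_wpM2r ?invr_ge0 //.
  have y0 : 0 <= y by rewrite ler0n.
  by move: h1 h2 y0; clear; move: (_ / _) x y (k%:R) => z x y u; lra.
have a1 : c / D%:R <= eps / 4.
  have h : 4 * c / eps <= D%:R by apply: le_trans hD1 _; rewrite ler_nat ltnW.
  rewrite ler_pdivrMr // in h; rewrite ler_pdivrMr //; lra.
have a2 : 2 / 3 / j%:R <= eps / 2.
  have h : 2 / eps <= j%:R by apply: le_trans hj0 _; rewrite ler_nat.
  rewrite ler_pdivrMr // in h; rewrite ler_pdivrMr //; lra.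
apply: (le_trans (lerD a1 a2)); clear -eps0; lra.
Qed.

Lemma matching_prob_large (rho : R) : 0 <= rho -> rho < 81 / 191 ->
  exists D1 r : nat, forall D, (D1 <= D)%N ->
  forall (V E : finType) (vs : E -> {set V}) (F : {set E}),
    (forall e, #|vs e| = 3%N) -> injective vs -> (forall v, (#|star vs F v| <= D)%N) ->
  forall e, e \in F ->
  rho / D%:R <= mean (fun w : rounds E (3 * D) r => (e \in composite vs F w)%:R).
Proof.
move=> r0 rlt; pose eta := 1 - 191 / 81 * rho.
have eta0 : 0 < eta by rewrite /eta; lra.
pose l : R := 52 / 243 - eta / 6.
have l0 : 0 <= l by rewrite /l /eta; lra.
have l4 : l <= 2^-1 by rewrite /l; lra.
have eps0 : 0 < eta / 6 by lra.
have [D1 hD] := idle_large eps0.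
have [r hr] := exists_nat_ge (2 / eta).
exists (maxn 1 D1), r => D; rewrite geq_max => /andP[D0 DD] V E vs F vs3 vsI starD e eF.
have ne := vs_neq0 vs3.
have n0 : (0 < 3 * D)%N by rewrite muln_gt0.
have li := hD D DD V E vs F vs3 vsI starD e eF.
have l1 : l < 1 by lra.
apply: le_trans (@mean_composite_ge V E vs F (3 * D) R ne n0
  (fun f _ => card_nbr vs3 starD f) r e l eF l0 l1 li).
have dR : 0 < D%:R :> R by rewrite ltr0n.
have lr : l ^+ r <= eta / 2.
  apply: (@le_trans _ _ (2^-1 ^+ r)); first by rewrite lerXn2r ?nnegrE // invr_ge0.
  have h2 : 2 / eta <= 2 ^+ r.
    by apply: (le_trans hr); rewrite -natrX ler_nat ltnW // ltn_expl.
  rewrite exprVn -[leRHS]invrK lef_pV2 ?posrE ?invr_gt0 ?exprn_gt0 //; last by lra.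
  by rewrite invf_div.
have e3 : (3 * D)%N%:R = 3 * D%:R :> R by rewrite natrM.
rewrite e3 invfM; set X := (1 - l ^+ r) / (1 - l).
suff h : rho <= X / 3 by rewrite [X * _]mulrA ler_wpM2r // invr_ge0 ltW.
rewrite ler_pdivlMr // /X ler_pdivlMr; last by lra.
have : rho * 3 * (eta / 6) <= 3 / 2 * (eta / 6) by rewrite ler_wpM2r //; lra.
rewrite /l; move: lr; rewrite /l; move: (_ ^+ r) => z; rewrite /eta; nra.
Qed.

Lemma exp_tail_small (a c : R) : 0 < c -> exists D1 : nat, forall D, (D1 <= D)%N ->
  (4 * (243 * D ^ 5))%N%:R * expR (a - c * D%:R) <= 1.
Proof.
move=> c0; have c6 : 0 < c ^+ 6 / 6`!%:R by rewrite divr_gt0 ?exprn_gt0 // ltr0n fact_gt0.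
have [D1 hD] := exists_nat_ge (972 * expR a / (c ^+ 6 / 6`!%:R)).
exists D1 => D DD.
have {}hD : 972 * expR a <= D%:R * (c ^+ 6 / 6`!%:R).
  by rewrite -ler_pdivrMr // (le_trans hD) // ler_nat.
rewrite expRD expRN mulrA ler_pdivrMr ?expR_gt0 // mul1r.
have D0 : 0 <= c * D%:R by rewrite mulr_ge0 // ltW.
apply: le_trans (expR_ge1Dxn 5 D0).
apply: (@le_trans _ _ ((c * D%:R) ^+ 6 / 6`!%:R)); last by rewrite lerDr.
have -> : (4 * (243 * D ^ 5))%N%:R = 972 * D%:R ^+ 5 :> R.
  by rewrite mulnA natrM natrX.
have -> : (c * D%:R) ^+ 6 / 6`!%:R = D%:R * (c ^+ 6 / 6`!%:R) * D%:R ^+ 5.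
  by rewrite exprMn (exprS D%:R 5); ring.
by rewrite mulrAC ler_wpM2r // exprn_ge0.
Qed.

Lemma degree_step (mu : R) : 191 / 81 < mu -> exists D1 : nat, forall D, (D1 <= D)%N ->
  forall (V E : finType) (vs : E -> {set V}) (F : {set E}),
    (forall e, #|vs e| = 3%N) -> injective vs -> (forall v, (#|star vs F v| <= D)%N) ->
  exists D' m (F' : {set E}), [/\ (D' < D)%N, m%:R <= mu * (D%:R - D'%:R),
    (forall v, (#|star vs F' v| <= D')%N) &
    forall n, colorable vs F' n -> colorable vs F (n + m)].
Proof.
move=> mu_gt; have mu0 : 0 < mu by lra.
pose rho := (mu^-1 + 81 / 191) / 2.
have imu : mu^-1 < 81 / 191.
  by rewrite -(invf_div 191 81) ltf_pV2 ?posrE //; lra.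
have imu0 : 0 < mu^-1 by rewrite invr_gt0.
have rho0 : 0 <= rho by rewrite /rho; lra.
have rho_lt : rho < 81 / 191 by rewrite /rho; lra.
pose eta := (rho * mu - 1) / 4.
have rmu : rho * mu = 1 + 4 * eta by rewrite /eta; field.
have eta0 : 0 < eta.
  rewrite /eta divr_gt0 // subr_gt0 -(mulVf (lt0r_neq0 mu0)) ltr_pM2r // /rho; lra.
pose kap := eta / (1 + 4 * eta).
have e40 : 0 < 1 + 4 * eta by lra.
have kap0 : 0 < kap by rewrite divr_gt0.
have kap1 : kap < 1 by rewrite ltr_pdivrMr //; lra.
pose p := rho * (1 - kap).
have pmu : p * mu = 1 + 3 * eta.
  by rewrite /p mulrAC rmu /kap; field; rewrite gt_eqF.
have p0 : 0 <= p by rewrite mulr_ge0 // subr_ge0 ltW.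
have p1 : p <= 1.
  by apply: mulr_ile1 => //; rewrite ?subr_ge0 ?gerBl ltW //; lra.
pose x := (1 + eta)^-1.
have x0 : 0 < x by rewrite invr_gt0; lra.
have x1 : x < 1 by rewrite invf_lt1; lra.
pose y := p * (1 - x).
have y0 : 0 <= y by rewrite mulr_ge0 // subr_ge0 ltW.
have y1 : y <= 1.
  by apply: mulr_ile1 => //; rewrite ?subr_ge0 ?gerBl ltW.
pose c := y * mu - eta.
have c0 : 0 < c.
  have -> : c = 2 * eta ^+ 2 / (1 + eta).
    rewrite /c /y mulrAC pmu /x; field; rewrite gt_eqF //; lra.
  by rewrite divr_gt0 ?mulr_gt0 ?exprn_gt0 //; lra.
have [D1 hD1] := exp_tail_small (y + c) (mulr_gt0 c0 kap0).
have [D2 [r hD2]] := matching_prob_large rho0 rho_lt.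
have [D3 hD3] := exists_nat_ge kap^-1.
exists (maxn 1 (maxn D1 (maxn D2 D3))) => D; rewrite !geq_max.
move=> /and4P[D0 DD1 DD2 DD3] V E vs F vs3 vsI starD.
have dR : 0 < D%:R :> R by rewrite ltr0n.
have kD1 : 1 <= kap * D%:R.
  have : kap^-1 <= D%:R by rewrite (le_trans hD3) // ler_nat.
  by move/(ler_wpM2l (ltW kap0)); rewrite divff // gt_eqF.
have kD0 : 0 <= kap * D%:R by lra.
have [K hK1 hK2] := floor_nat kD0.
have muK : 0 <= mu * K%:R by rewrite mulr_ge0 ?ler0n // ltW.
have [m hm1 hm2] := floor_nat muK.
have K0 : (0 < K)%N.
  by rewrite -(ltr0n R); lra.
have KD : (K <= D)%N.
  rewrite -(ler_nat R) (le_trans hK1) // ler_piMl // ltW //.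
have ne := vs_neq0 vs3.
have n0 : (0 < 3 * D)%N by rewrite muln_gt0.
have prob := hD2 D DD2 V E vs F vs3 vsI starD.
have rD : 0 <= rho / D%:R by rewrite divr_ge0 // ltW.
have pD : p <= (D - K)%N%:R * (rho / D%:R).
  rewrite natrB // mulrCA /p ler_wpM2l //.
  rewrite ler_pdivlMr //; lra.
have small : (4 * (243 * D ^ 5))%N%:R *
    ((1 - p * (1 - x)) ^+ m * x^-1 ^+ (D - (D - K))) <= 1.
  apply: le_trans (hD1 D DD1); rewrite ler_wpM2l // subKn // -/y /x invrK.
  have h1 : (1 - y) ^+ m <= expR (- y * m%:R).
    by rewrite expRM_natr lerXn2r ?nnegrE ?subr_ge0 ?expR_ge0 // expR_ge1Dx.
  have h2 : (1 + eta) ^+ K <= expR (eta * K%:R).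
    by rewrite expRM_natr lerXn2r ?nnegrE ?expR_ge0 ?expR_ge1Dx //; lra.
  apply: le_trans (ler_pM _ _ h1 h2) _; rewrite ?exprn_ge0 ?subr_ge0 //; first by lra.
  rewrite -expRD ler_expR.
  have : y * (mu * K%:R) <= y * (m%:R + 1) by rewrite ler_wpM2l // ltW.
  have : c * (kap * D%:R) <= c * (K%:R + 1) by rewrite ler_wpM2l // ltW.
  by rewrite /c; lra.
have [w hw] := @exists_good_draws V E vs F D R vs3 starD _ _ _ _ rD (card_rounds E (3 * D) r)
  (@composite_matching V E vs F (3 * D) r) (@resamplable_rounds E (3 * D) r)
  (@composite_local V E vs F (3 * D) ne r) prob m (D - K) p x D0 x0 (ltW x1) p0 p1 pD small.
exists (D - K)%N, m, (left_over (@composite V E vs F (3 * D) r) F w); split.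
- by rewrite -subn_gt0 subKn.
- by rewrite natrB // opprB addrC subrK.
- exact: hw.
- by move=> n; apply: colorable_left_over; apply: composite_matching.
Qed.

Lemma colorable_linear (mu : R) : 191 / 81 < mu -> exists C : R,
  forall (V E : finType) (vs : E -> {set V}) (F : {set E}) (D : nat),
    (forall e, #|vs e| = 3%N) -> injective vs -> (forall v, (#|star vs F v| <= D)%N) ->
  exists2 n, n%:R <= mu * D%:R + C & colorable vs F n.
Proof.
move=> mu_gt; have [D1 step] := degree_step mu_gt.
exists (3 * D1)%N%:R => V E vs F D vs3 vsI.
elim/ltn_ind: D F => D IH F starD.
have [DD|DD] := leqP D1 D.
  have [D' [m [F' [D'D hm star' col]]]] := step D DD V E vs F vs3 vsI starD.
  have [n hn cn] := IH D' D'D F' star'.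
  exists (n + m)%N; last exact: col.
  by rewrite natrD; lra.
exists (3 * D)%N.
  rewrite ler_wpDl ?mulr_ge0 ?ler0n //; first by lra.
  by rewrite ler_nat leq_mul2l ltnW.
by apply: colorable_greedy => [|e eF]; [exact: vs_neq0 | exact: card_nbr].
Qed.

End Asymptotics.

Lemma chromatic_index_le (H : hypergraph) (n : nat) :
  colorable (@vset H) setT n -> (chromatic_index H <= n)%N.
Proof.
move=> [c [cn cp]]; rewrite /chromatic_index; case: ex_minnP => k _; apply.
apply/existsP; exists [ffun e => Ordinal (cn e (in_setT e))].
apply/forallP => e; apply/forallP => f; apply/implyP => /andP[ef i].
by rewrite !ffunE -val_eqE /= cp ?in_setT.
Qed.

Lemma chromatic_index_linear (R : realType) (mu : R) : 191 / 81 < mu -> exists C : R,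
  forall H : hypergraph, uniform 3 H -> simple 2 H ->
    (chromatic_index H)%:R <= mu * (max_degree H)%:R + C.
Proof.
move=> /colorable_linear[C HC]; exists C => H u3 s2.
have vsI : injective (@vset H).
  move=> e f ef; apply/eqP; apply: contraT => /s2.
  by rewrite ef setIid u3.
have [v|n hn cn] := HC _ _ (@vset H) setT (max_degree H) u3 vsI _.
  apply: leq_trans (leq_bigmax v); rewrite /degree.
  by apply/eq_leq/eq_card => e; rewrite !inE.
by apply: le_trans hn; rewrite ler_nat chromatic_index_le.
Qed.

Theorem theorem1p2 (R : realType) :
  (forall iota : R, 0 < iota ->
    exists D0 : R, forall D : R, D0 <= D ->
      forall H : hypergraph,
        uniform 3 H -> simple 2 H -> (max_degree H)%:R <= D ->
        (chromatic_index H)%:R <=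
          (1 - 2 / 9 + 2 / 3 ^+ 5 + iota) * (3 * D))
  /\
  (exists D0 : R, forall D : R, D0 <= D ->
      forall H : hypergraph,
        uniform 3 H -> simple 2 H -> (max_degree H)%:R <= D ->
        (chromatic_index H)%:R <= (2 + 3581 / 10 ^+ 4) * D).
Proof.
have bound (nu : R) : 191 / 81 < nu -> exists D0 : R, forall D : R, D0 <= D ->
    forall H : hypergraph, uniform 3 H -> simple 2 H -> (max_degree H)%:R <= D ->
    (chromatic_index H)%:R <= nu * D.
  move=> nu_gt; pose mu := (191 / 81 + nu) / 2.
  have [|C HC] := @chromatic_index_linear R mu; first by rewrite /mu; lra.
  have s0 : 0 < (nu - 191 / 81) / 2 by lra.
  exists (C / ((nu - 191 / 81) / 2)) => D; rewrite ler_pdivrMr // => DC H u3 s2 dD.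
  apply: le_trans (HC H u3 s2) _.
  have : mu * (max_degree H)%:R <= mu * D by rewrite ler_wpM2l // /mu; lra.
  by rewrite /mu; lra.
split=> [iota iota0|]; last by apply: bound; lra.
have [|D0 HD0] := bound (3 * (1 - 2 / 9 + 2 / 3 ^+ 5 + iota)); first by lra.
exists D0 => D DD H u3 s2 dD; rewrite mulrA [_ * 3]mulrC; exact: HD0.
Qed.
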